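(* The following conditions are equivalent. (i) The semigroup $(R_t)$ is symmetric in $L^2(H,\mu)$. (ii) If $x\in\mathrm{dom}(A^* )$ then $Qx\in\mathrm{dom}(A)$ and $AQx=QA^*x$. (iii) $S(t)Q=QS^*(t)$ for all $t\ge 0$.
   Context: $H$ is a separable real Hilbert space with inner product $\langle\cdot,\cdot\rangle$ and norm $|\cdot|$. $Q$ is a bounded selfadjoint nonnegative operator on $H$, $A$ is the generator of a strongly continuous semigroup $(S(t))_{t\ge0}$ on $H$, and $W$ is a standard cylindrical Wiener process on $H$. Put $Q_t=\int_0^tS(s)QS^*(s)\,ds$ for $0<t\le\infty$. Standing assumption: $\int_0^\infty\mathrm{tr}(S(s)QS^*(s))\,ds<\infty$ and $Q_\infty$ is injective. The Ornstein-Uhlenbeck process is $Z(t,x)=S(t)x+\int_0^tS(t-s)Q^{1/2}\,dW(s)$, and $R_t\phi(x)=E\phi(Z(t,x))$ for bounded Borel $\phi$. Then the centered Gaussian measure $\mu=N(0,Q_\infty)$ is invariant for $(R_t)$, and $(R_t)$ extends to a $C_0$-semigroup of contractions on $L^p(H,\mu)$, $p\in[1,\infty)$. ''$(R_t)$ is symmetric'' means that $R_t$ is a symmetric operator in $L^2(H,\mu)$ for every $t\ge0$. *)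

(* Defs.v *)
(* Ornstein-Uhlenbeck semigroups on a separable real Hilbert space
   (MathComp-Analysis). *)
From HB Require Import structures.
From mathcomp Require Import all_boot all_order all_algebra.
From mathcomp Require Import all_classical all_reals all_analysis.
Import Order.TTheory GRing.Theory Num.Theory.
Import numFieldNormedType.Exports.

Set Implicit Arguments.
Unset Strict Implicit.
Unset Printing Implicit Defensive.

Local Open Scope classical_set_scope.
Local Open Scope ring_scope.

Definition separable_space (T : topologicalType) : Prop :=
  exists2 D : set T, countable D & dense D.

Definition borel (T : ptopologicalType) := g_sigma_algebraType (@open T).

Section Hilbert.
Context (R : realType) (H : completeNormedModType R) (ip : {dot H for idfun}).

(* The norm (and hence the complete topology) of H is the one given by the
   inner product. *)
Definition is_hilbert : Prop := forall x : H, `|x| ^+ 2 = ip x x.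

(* A set rather than a sequence, so that dim H may be finite or infinite. *)
Definition orthonormal_basis (B : set H) : Prop :=
  (forall b c, B b -> B c -> ip b c = (b == c)%:R) /\
  dense [set x : H | exists (n : nat) (a : 'I_n -> R) (b : 'I_n -> H),
                     (forall i, B (b i)) /\ x = \sum_(i < n) a i *: b i].

(* The trace of a nonnegative operator, which is an element of [0, +oo]. *)
Definition trace (B : set H) (T : H -> H) : \bar R :=
  \esum_(b in B) (ip (T b) b)%:E.

Definition selfadjoint (T : H -> H) : Prop :=
  forall x y, ip (T x) y = ip x (T y).

Definition nonnegative_op (T : H -> H) : Prop := forall x, 0 <= ip (T x) x.

(* A bounded operator is a continuous linear map. *)
Definition is_sqrt_op (Q K : {linear H -> H}) : Prop :=
  [/\ continuous K, selfadjoint K, nonnegative_op K & forall x, K (K x) = Q x].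

(* Adjoint of an operator T with domain D, which is unique on its domain as
   soon as D is dense. *)
Definition adj_dom (D : set H) (T : H -> H) : set H :=
  [set y | exists z, forall x, D x -> ip (T x) y = ip x z].

Definition adj (D : set H) (T : H -> H) (y : H) : H :=
  xget 0 [set z | forall x, D x -> ip (T x) y = ip x z].

Definition C0_semigroup (S : R -> {linear H -> H}) : Prop :=
  [/\ forall t, 0 <= t -> continuous (S t),
      forall x, S 0 x = x,
      forall s t x, 0 <= s -> 0 <= t -> S (s + t) x = S s (S t x)
    & forall x, S t x @[t --> 0^'+] --> x].

Definition gen_dom (S : R -> {linear H -> H}) : set H :=
  [set x | cvg (t^-1 *: (S t x - x) @[t --> 0^'+])].

Definition gen (S : R -> {linear H -> H}) (x : H) : H :=
  lim (t^-1 *: (S t x - x) @[t --> 0^'+]).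

Definition Sadj (S : R -> {linear H -> H}) (t : R) : H -> H := adj setT (S t).

(* The integral of f : R -> H over D, determined by the integrals of its
   coordinates. *)
Definition vintegral (D : set R) (f : R -> H) : H :=
  xget 0 [set y | forall h,
    lebesgue_measure.-integrable D (fun s => (ip (f s) h)%:E) /\
    ip y h = \int[lebesgue_measure]_(s in D) ip (f s) h].

Definition Qinf (S : R -> {linear H -> H}) (Q : {linear H -> H}) (x : H) : H :=
  vintegral `[0, +oo[ (fun s => S s (Q (Sadj S s x))).

Definition finite_trace (B : set H) (S : R -> {linear H -> H})
    (Q : {linear H -> H}) : Prop :=
  (\int[lebesgue_measure]_(s in `[0%R, +oo[)
     trace B (fun x => S s (Q (Sadj S s x))) < +oo)%E.

(* The Gaussian law N(m, v) on R with mean m and variance v >= 0.  The library's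
   normal_prob m 0 is not the Dirac mass at m. *)
Definition normal_law (m v : R) (B : set R) : \bar R :=
  if v == 0 then \d_m B else normal_prob m (Num.sqrt v) B.

(* mu = N(0, C) *)
Definition centered_gaussian (mu : probability (borel H) R) (C : H -> H) :
    Prop :=
  forall (h : H) (B : set R), measurable B ->
    mu ((fun x => ip x h) @^-1` B) = normal_law 0 (ip (C h) h) B.

Section Process.
Context d (Omega : measurableType d) (P : probability Omega R).

(* A cylindrical Wiener process is given by the real processes W(t)h: they form
   a centered Gaussian family with covariance E[W(s)h W(t)k] = min(s,t) <h,k>,
   and each t |-> W(t)h has continuous paths almost surely.  Applied to
   W(t)(ah + bk) - a W(t)h - b W(t)k, of variance 0, the first condition contains
   the linearity of h |-> W(t)h almost surely. *)
Definition cylindrical_wiener (W : R -> H -> {RV P >-> R}) : Prop :=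
  (forall (n : nat) (c t : 'I_n -> R) (h : 'I_n -> H),
     (forall i, 0 <= t i) ->
     forall B : set R, measurable B ->
       P ((fun w => \sum_(i < n) c i * W (t i) (h i) w) @^-1` B) =
       normal_law 0 (\sum_(i < n) \sum_(j < n)
         c i * c j * Num.min (t i) (t j) * ip (h i) (h j)) B) /\
  (forall h, {ae P, forall w,
     {within `[0, +oo[, continuous (fun t => W t h w)}}).

(* A triple ((a, b), h) stands for the step function 1_]a, b] h. *)
Definition step_fun (p : seq (R * R * H)) (s : R) : H :=
  \sum_(i <- p) (\1_(`]i.1.1, i.1.2]) s : R) *: i.2.

Definition step_int (W : R -> H -> {RV P >-> R}) (p : seq (R * R * H))
    (w : Omega) : R :=
  \sum_(i <- p) (W i.1.2 i.2 w - W i.1.1 i.2 w).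

(* X = \int_0^t <f(s), dW(s)> for a deterministic f in L^2(0, t; H), the
   extension of the elementary integral by the Ito isometry. *)
Definition is_wiener_integral (W : R -> H -> {RV P >-> R}) (t : R)
    (f : R -> H) (X : Omega -> R) : Prop :=
  exists p : nat -> seq (R * R * H),
    [/\ forall n, all (fun i => [&& 0 <= i.1.1, i.1.1 <= i.1.2 & i.1.2 <= t]) (p n),
        (\int[lebesgue_measure]_(s in `[0%R, t])
           (`|f s - step_fun (p n) s| ^+ 2)%:E)%E @[n --> \oo] --> 0%E
      & (\int[P]_w ((X w - step_int W (p n) w) ^+ 2)%:E)%E
           @[n --> \oo] --> 0%E].

(* I(t) = \int_0^t S(t-s) K dW(s), where K = Q^(1/2).  Since K is selfadjoint,
   <I(t), h> = \int_0^t <K S*(t-s) h, dW(s)>. *)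
Definition stochastic_convolution (W : R -> H -> {RV P >-> R})
    (S : R -> {linear H -> H}) (K : {linear H -> H})
    (I : R -> {mfun Omega >-> borel H}) : Prop :=
  forall t, 0 <= t -> forall h,
    is_wiener_integral W t (fun s => K (Sadj S (t - s) h))
      (fun w => ip (I t w) h).

Definition OU (S : R -> {linear H -> H}) (I : R -> {mfun Omega >-> borel H})
    (t : R) (x : H) (w : Omega) : H := S t x + I t w.

Definition transition (Z : R -> H -> Omega -> H) (t : R) (phi : H -> R)
    (x : H) : R :=
  fine ('E_P[fun w => phi (Z t x w)])%E.

End Process.

Definition bounded_borel (phi : borel H -> R) : Prop :=
  measurable_fun [set: borel H] phi /\ exists M, forall x, `|phi x| <= M.

(* T is the family of contractions of L^2(H, mu) extending the operators Rt t
   from the bounded Borel functions, which are dense.  Operators on L^2(H, mu)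
   are given on representatives; linearity and contractivity make them respect
   equality almost everywhere. *)
Definition L2_extension (mu : probability (borel H) R)
    (Rt T : R -> (borel H -> R) -> (borel H -> R)) : Prop :=
  forall t, 0 <= t ->
    [/\ forall f, f \in Lfun mu 2%:E -> T t f \in Lfun mu 2%:E,
        forall (a : R) f g, f \in Lfun mu 2%:E -> g \in Lfun mu 2%:E ->
          {ae mu, forall x,
             T t (fun y => a * f y + g y) x = a * T t f x + T t g x},
        forall f, f \in Lfun mu 2%:E ->
          ('N[mu]_2%:E[EFin \o T t f] <= 'N[mu]_2%:E[EFin \o f])%E
      & forall phi, bounded_borel phi ->
          {ae mu, forall x, T t phi x = Rt t phi x}].

Definition L2_symmetric (mu : probability (borel H) R)
    (T : R -> (borel H -> R) -> (borel H -> R)) : Prop :=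
  forall t, 0 <= t -> forall f g,
    f \in Lfun mu 2%:E -> g \in Lfun mu 2%:E ->
    \int[mu]_x (T t f x * g x) = \int[mu]_x (f x * T t g x).

End Hilbert.

(* Main.v *)
Require Import Defs.
From mathcomp Require Import all_boot all_order all_algebra.
From mathcomp Require Import all_classical all_reals all_analysis.
From mathcomp Require Import measurable_realfun ring lra.
Import Order.TTheory GRing.Theory Num.Theory.
Import numFieldNormedType.Exports.
Local Open Scope classical_set_scope.
Local Open Scope ring_scope.
Set Implicit Arguments.
Unset Strict Implicit.
Unset Printing Implicit Defensive.


(** Let A be the generator of S, S*(t) the adjoint of S(t), and Q_t the integral of
    S(s) Q S*(s) over [0, t]. The proof goes through a fourth condition,
    S(t) Qinf = Qinf S*(t) for all t >= 0, which is a relation between the covariances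
    of mu.

    The symmetry of R_t is equivalent to this condition. The law of Z(t, x) is
    N(S(t) x, Q_t), so R_t maps the function cos(<., h> + a) to
    exp(- <Q_t h, h> / 2) cos(<., S*(t) h> + a) ([transition_cos]). By the invariance
    Qinf = Q_t + S(t) Qinf S*(t) ([qcov_split]), the product in L^2(mu) of this function
    with cos(<., k> + b) is, up to a factor which is symmetric in h and k,
    cos(a + b) exp(- c) + cos(a - b) exp c, where c = <Qinf S*(t) h, k>
    ([pairing_cos]). So R_t is symmetric on these functions if and only if
    <Qinf S*(t) h, k> = <Qinf S*(t) k, h> for all h and k. The trigonometric functions
    are dense in L^2(mu) ([L2_trig_dense]) and R_t is a contraction, hence the symmetry
    extends to L^2(mu) ([symmetric_of_trig]). Two computations are behind this: the
    characteristic function of a normal law, found by solving a differential equation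
    ([normal_cosE]), and that of a Wiener integral, by approximation with step functions
    ([cos_wiener_integral]).

    The fourth condition is equivalent to the intertwining S(t) Q = Q S*(t). It follows
    from it under the integral which defines Qinf ([intertwine_qcov]). Conversely, it
    implies <Q_t S*(r) h, k> = <Q_t h, S*(r) k>; divide by t and let t tend to 0
    ([qcov_intertwine]). For the limit one takes k in the domain of A*, where S* is
    strongly continuous at 0; this domain is weakly dense ([adj_gen_dense]).

    The intertwining is equivalent to the condition on the generator. Derivatives of
    orbits are replaced by the weak integrals V_t x of S(s) x over [0, t]
    ([integrated]): V_t x is in the domain of A, A V_t x = S(t) x - x, and
    V_t A x = S(t) x - x for x in the domain. From the intertwining one gets
    S(t) Q x - Q x = V_t Q A* x for x in the domain of A*, and divides by t
    ([intertwine_gen]). In the other direction, <Q S*(s) x, S*(t - s) y> has increments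
    of second order in s for x and y in the domain of A*, so it does not depend on s
    ([gen_intertwine]). *)

(** * Integrals and the characteristic function of the normal law *)

Section real_integrals.
Context d (T : measurableType d) {R : realType} (mu : {measure set T -> \bar R}).

Lemma Rintegral_dominated_cvg (D : set T) (f_ : nat -> T -> R) (f g : T -> R) :
  measurable D -> (forall n, measurable_fun D (f_ n)) ->
  (forall x, D x -> f_ n x @[n --> \oo] --> f x) ->
  mu.-integrable D (EFin \o g) -> (forall n x, D x -> `|f_ n x| <= g x) ->
  mu.-integrable D (EFin \o f) /\
  \int[mu]_(x in D) f_ n x @[n --> \oo] --> \int[mu]_(x in D) f x.
Proof.
move=> mD mf ff ig fg.
have mf' : measurable_fun D f by exact: (measurable_realfun.measurable_fun_cvg mf ff).
have ffE x : D x -> (f_ n x)%:E @[n --> \oo] --> (f x)%:E.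
  by move=> Dx; apply: cvg_EFin; [exact: nearW|exact: ff].
have [i _ c] := @dominated_convergence _ _ _ mu D mD
  (fun n => EFin \o f_ n) (EFin \o f) (EFin \o g)
  (fun n => (measurable_EFinP _ _).2 (mf n)) ((measurable_EFinP _ _).2 mf')
  (aeW _ ffE) ig
  (aeW _ (fun x n Dx => fg n x Dx : (`|(f_ n x)%:E| <= (g x)%:E)%E)).
split=> //; apply: fine_cvg; rewrite fineK//.
exact: integrable_fin_num.
Qed.

Lemma integrable_linear (D : set T) (a : R) (f g : T -> R) : measurable D ->
  mu.-integrable D (EFin \o f) -> mu.-integrable D (EFin \o g) ->
  mu.-integrable D (EFin \o (fun x => a * f x + g x)).
Proof.
move=> mD fi gi; have := integrableD mD (integrableZl mD a fi) gi.
by apply: eq_integrable => // x _.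
Qed.

Lemma integrable_scale (D : set T) (a : R) (f : T -> R) : measurable D ->
  mu.-integrable D (EFin \o f) -> mu.-integrable D (EFin \o (fun x => a * f x)).
Proof. by move=> mD fi; have := integrableZl mD a fi; apply: eq_integrable. Qed.

Lemma integrable_sub (D : set T) (f g : T -> R) : measurable D ->
  mu.-integrable D (EFin \o f) -> mu.-integrable D (EFin \o g) ->
  mu.-integrable D (EFin \o (fun x => f x - g x)).
Proof. by move=> mD fi gi; have := integrableB mD fi gi; apply: eq_integrable. Qed.

Lemma Rintegral_linear (D : set T) (a : R) (f g : T -> R) : measurable D ->
  mu.-integrable D (EFin \o f) -> mu.-integrable D (EFin \o g) ->
  \int[mu]_(x in D) (a * f x + g x) = a * \int[mu]_(x in D) f x + \int[mu]_(x in D) g x.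
Proof.
move=> mD fi gi; rewrite RintegralD//; first by rewrite RintegralZl.
have := integrableZl mD a fi; by apply: eq_integrable => // x _.
Qed.

Lemma Rintegral_sum_seq (I : eqType) (l : seq I) (D : set T) (F : I -> T -> R) :
  measurable D -> (forall i, i \in l -> mu.-integrable D (EFin \o F i)) ->
  mu.-integrable D (EFin \o (fun x => \sum_(i <- l) F i x)) /\
  \int[mu]_(x in D) (\sum_(i <- l) F i x) = \sum_(i <- l) \int[mu]_(x in D) F i x.
Proof.
move=> mD; elim: l => [|i l IH] Fi.
  have -> : (fun x => \sum_(i <- [::]) F i x) = cst 0 by apply/funext => x; rewrite big_nil.
  by rewrite big_nil Rintegral_cst// mul0r; split=> //; exact: integrable0.
have [IH1 IH2] := IH (fun j jl => Fi j (mem_behead (s := i :: l) jl)).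
have i1 := Fi i (mem_head i l).
have -> : (fun x => \sum_(j <- i :: l) F j x) = (fun x => F i x + \sum_(j <- l) F j x).
  by apply/funext => x; rewrite big_cons.
rewrite big_cons RintegralD// IH2; split=> //.
by have := integrableD mD i1 IH1; apply: eq_integrable.
Qed.
Lemma ae_Rintegral (f g : T -> R) : measurable_fun setT f -> measurable_fun setT g ->
  {ae mu, forall x, f x = g x} -> \int[mu]_x f x = \int[mu]_x g x.
Proof.
move=> mf mg fg; congr fine; apply: ae_eq_integral => //; try exact/measurable_EFinP.
by move: fg; apply: filterS => x ->.
Qed.
End real_integrals.

Section gaussian.
Context {R : realType}.
Implicit Types s x : R.
Local Notation leb := (@lebesgue_measure R).

Lemma is_derive_normal_pdf s x : s != 0 ->
  is_derive x 1 (normal_pdf 0 s) (- (x / s ^+ 2) * normal_pdf 0 s x).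
Proof.
move=> s0; rewrite normal_pdfE// /normal_fun.
apply: is_derive_eq.
rewrite /GRing.scale /= ?subr0.
by field.
Qed.

(** This is the domination used below to differentiate under the integral: with
    y = |x| / s it says that y <= exp (3 y^2 / 8), a consequence of 1 + z <= exp z. *)
Lemma abs_normal_pdf_le s x : 0 < s ->
  `|x| * normal_pdf 0 s x <= 2 * s * normal_pdf 0 (2 * s) x.
Proof.
move=> s0; rewrite !normal_pdfE ?gt_eqF ?mulr_gt0// /normal_fun /normal_peak !subr0.
have -> : Num.sqrt ((2 * s) ^+ 2 * pi *+ 2) = 2 * Num.sqrt (s ^+ 2 * pi *+ 2).
  rewrite exprMn -mulrA -mulrnAr sqrtrM ?exprn_ge0//.
  by rewrite sqrtr_sqr ger0_norm.
set c := Num.sqrt _.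
have c0 : 0 < c by rewrite sqrtr_gt0 mulrn_wgt0// mulr_gt0// ?exprn_gt0// pi_gt0.
rewrite invfM mulrCA [leRHS](_ : _ = c^-1 * (s * expR (- x ^+ 2 / ((2 * s) ^+ 2 *+ 2)))); last by field; lra.
rewrite ler_pM2l ?invr_gt0//.
set y := `|x| / s.
have y0 : 0 <= y by rewrite divr_ge0 // ltW.
have xE : `|x| = s * y by rewrite /y; field; lra.
have x2 : x ^+ 2 = s ^+ 2 * y ^+ 2 by rewrite -exprMn -xE real_normK ?num_real.
rewrite xE x2 -mulrA ler_pM2l//.
have -> : - (s ^+ 2 * y ^+ 2) / ((2 * s) ^+ 2 *+ 2) =
  3 / 8 * y ^+ 2 - (s ^+ 2 * y ^+ 2) / (s ^+ 2 *+ 2) by field; lra.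
rewrite expRD -!mulNr ler_wpM2r ?expR_ge0//.
apply: le_trans (expR_ge1Dx _).
have := sqr_ge0 (y - 4/3); lra.
Qed.

(** The fundamental theorem of calculus on [-n, n]: the decay of U makes the
    boundary terms O(1/n). *)
Lemma Rintegral_derive_eq0 (U u : R -> R) (C : R) :
  (forall x, is_derive x 1 U (u x)) -> continuous u ->
  leb.-integrable setT (EFin \o u) -> (forall x, `|x| * `|U x| <= C) ->
  \int[leb]_x u x = 0.
Proof.
move=> dU cu iu UC.
pose D (n : nat) := [set` `[- n.+1%:R, n.+1%:R : R]].
have FTC n : (\int[leb]_(x in D n) (u x)%:E)%E = (U n.+1%:R - U (- n.+1%:R))%:E.
  rewrite EFinB; apply: continuous_FTC2.
  - by rewrite gtrN.
  - exact: continuous_subspaceT.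
  - have cU : continuous U.
      move=> x; apply: differentiable_continuous; apply/derivable1_diffP.
      exact: ex_derive.
    split=> [x _| |]; [exact: ex_derive| |].
    + exact/cvg_at_right_filter/cU.
    + exact/cvg_at_left_filter/cU.
  - by move=> x _; rewrite derive1E derive_val.
have cD x : (u \_ (D n)) x @[n --> \oo] --> u x.
  apply: cvg_near_cst; near=> n.
  have Dx : D n x.
    rewrite /D/= in_itv/= -ler_norml.
    apply: (le_trans (_ : _ <= n%:R)); last by rewrite ler_nat.
    by near: n; exact: nbhs_infty_ger.
  by rewrite patchE mem_set.
have /integrableP[/measurable_EFinP mu_ _] := iu.
have [||||_ lim] := @Rintegral_dominated_cvg _ _ _ leb setT
    (fun n => u \_ (D n)) u (fun x => `|u x|) measurableT.
- move=> n; have mD : measurable (D n) by rewrite /D.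
  by apply/(measurable_restrictT _ mD); exact: measurable_funTS.
- by move=> x _; exact: cD.
- exact: integrable_norm.
- by move=> n x _; rewrite patchE; case: ifP; rewrite // normr0.
apply/esym/(cvg_unique _ _ lim) => //.
have -> : (fun n => \int[leb]_x (u \_ (D n)) x) = (fun n => U n.+1%:R - U (- n.+1%:R)).
  by apply/funext => n; rewrite -Rintegral_mkcond /Rintegral FTC.
apply: norm_cvg0; apply: (@squeeze_cvgr _ _ _ _ (cst 0) (fun n => 2 * C * harmonic n)).
- near=> n; rewrite normr_ge0/= (le_trans (ler_normB _ _))//.
  have UC' x : x != 0 -> `|U x| <= C * `|x|^-1.
    by move=> x0; rewrite ler_pdivlMr ?normr_gt0// mulrC.
  have := UC' n.+1%:R; have := UC' (- n.+1%:R).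
  rewrite oppr_eq0 pnatr_eq0 normrN (ger0_norm (ler0n R n.+1)) => /(_ isT) h1 /(_ isT) h2.
  rewrite /harmonic/=. apply: le_trans (lerD h2 h1) _. by rewrite -mulrDl -mulr2n mulr_natl.
- exact: cvg_cst.
- by rewrite -[0](mulr0 (2 * C)); apply: cvgMr; exact: cvg_harmonic.
Unshelve. all: by end_near.
Qed.

(** [normal_prob] is the measure with density [normal_pdf], so this density is
    its Radon-Nikodym derivative almost everywhere. *)
Lemma Rintegral_normal_prob s (f : R -> R) (M : R) : s != 0 ->
  measurable_fun setT f -> (forall x, `|f x| <= M) ->
  (\int[normal_prob 0 s]_x (f x)%:E = \int[leb]_x (f x * normal_pdf 0 s x)%:E)%E.
Proof.
move=> s0 mf fM; set nu := normal_prob 0 s.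
have numu : nu `<< leb by exact: normal_prob_dominates.
have fi : nu.-integrable setT (EFin \o f).
  apply: (le_integrable measurableT (g := cst M%:E)) => //.
  - exact/measurable_EFinP.
  - by move=> x _; rewrite lee_fin (le_trans (fM x))// ler_norm.
  - exact: finite_measure_integrable_cst.
rewrite -(Radon_Nikodym_change_of_variables numu)//=.
under [RHS]eq_integral do rewrite EFinM.
apply: ae_eq_integral => //=.
- apply: emeasurable_funM; first exact/measurable_EFinP.
  by apply: (measurable_int leb); exact: Radon_Nikodym_integrable.
- apply: emeasurable_funM; apply/measurable_EFinP => //.
  exact: measurable_normal_pdf.
- apply: ae_eqe_mul2l; rewrite Radon_NikodymE//=.
  case: cid => /= h [h1 h2 h3]; apply: integral_ae_eq => //=.
  + by apply/measurable_EFinP; exact: measurable_normal_pdf.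
  + by move=> E _ mE; rewrite -h3.
Qed.

Lemma measurable_cos_affine (a t : R) : measurable_fun setT (fun x : R => cos (t * x + a)).
Proof.
apply: continuous_measurable_fun => x; apply: continuous_comp; last exact: continuous_cos.
by apply: cvgD; [exact: mulrl_continuous|exact: cvg_cst].
Qed.

Lemma measurable_sin_affine (a t : R) : measurable_fun setT (fun x : R => sin (t * x + a)).
Proof.
apply: continuous_measurable_fun => x; apply: continuous_comp; last exact: continuous_sin.
by apply: cvgD; [exact: mulrl_continuous|exact: cvg_cst].
Qed.

(** The characteristic function of N(0, s^2) at t; the phase a treats its real
    and imaginary parts at once. *)
Definition normal_cos s (a t : R) : R := \int[leb]_x (cos (t * x + a) * normal_pdf 0 s x).

Lemma integrable_bounded_normal_pdf s (f : R -> R) (M : R) : 0 < s ->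
  measurable_fun setT f -> (forall x, `|f x| <= M) ->
  leb.-integrable setT (fun x => (f x * normal_pdf 0 s x)%:E).
Proof.
move=> s0 mf fM.
under eq_fun do rewrite EFinM.
apply: integrableMr => //; last exact: integrable_normal_pdf.
by exists M; split; [exact: num_real|move=> x Mx y _; exact: le_trans (fM y) (ltW Mx)].
Qed.

Lemma integrable_sublinear_normal_pdf s (f : R -> R) : 0 < s ->
  measurable_fun setT f -> (forall x, `|f x| <= `|x|) ->
  leb.-integrable setT (fun x => (f x * normal_pdf 0 s x)%:E).
Proof.
move=> s0 mf fx.
apply: (@le_integrable _ _ _ leb setT measurableT
  (fun x => (f x * normal_pdf 0 s x)%:E) (fun x => (2 * s * normal_pdf 0 (2 * s) x)%:E)).
- apply/measurable_EFinP; apply: measurable_funM => //; exact: measurable_normal_pdf.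
- move=> x _; rewrite lee_fin; apply: le_trans (ler_norm _).
  apply: le_trans (abs_normal_pdf_le x s0).
  rewrite normrM (ger0_norm (normal_pdf_ge0 _ _ _)).
  by apply: ler_wpM2r (fx x); exact: normal_pdf_ge0.
- under eq_fun do rewrite EFinM.
  apply: integrableZl => //; exact: integrable_normal_pdf.
Qed.

(** Integration by parts, since the density f satisfies f' = - (x / s^2) f. *)
Lemma normal_cos_by_parts s a t : 0 < s ->
  \int[leb]_x (x * sin (t * x + a) * normal_pdf 0 s x) = s ^+ 2 * t * normal_cos s a t.
Proof.
move=> s0; have sn0 : s != 0 by rewrite gt_eqF.
have mcos : measurable_fun setT (fun x => cos (t * x + a)).
  by exact: measurable_cos_affine.
have msin : measurable_fun setT (fun x => sin (t * x + a)).
  by exact: measurable_sin_affine.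
have ic : leb.-integrable setT (fun x => (cos (t * x + a) * normal_pdf 0 s x)%:E).
  by apply: (@integrable_bounded_normal_pdf _ _ 1) => // x; exact: cos_max.
have is_ : leb.-integrable setT (fun x => (x * sin (t * x + a) * normal_pdf 0 s x)%:E).
  apply: integrable_sublinear_normal_pdf => //; first exact: measurable_funM.
  by move=> x; rewrite normrM ler_piMr// sin_max.
pose u x := t * (cos (t * x + a) * normal_pdf 0 s x) - (s ^+ 2)^-1 * (x * sin (t * x + a) * normal_pdf 0 s x).
have iu : leb.-integrable setT (EFin \o u).
  have -> : EFin \o u = (fun x => t%:E * (cos (t * x + a) * normal_pdf 0 s x)%:E
      - (s ^+ 2)^-1%:E * (x * sin (t * x + a) * normal_pdf 0 s x)%:E)%E.
    by apply/funext => x; rewrite /u /= EFinB !EFinM.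
  by apply: integrableB => //; exact: integrableZl.
have cu : continuous u.
  move=> x; apply: differentiable_continuous; apply/derivable1_diffP.
  have := is_derive_normal_pdf x sn0 => dpdf.
  exact: ex_derive.
have dU x : is_derive x 1 (fun x => sin (t * x + a) * normal_pdf 0 s x) (u x).
  have := is_derive_normal_pdf x sn0 => dpdf.
  apply: is_derive_eq; rewrite /u /GRing.scale/=.
  by field.
have Ub x : `|x| * `|sin (t * x + a) * normal_pdf 0 s x| <= 2 * s * normal_peak (2 * s).
  rewrite normrM mulrCA (ger0_norm (normal_pdf_ge0 _ _ _)).
  apply: le_trans (ler_piMl _ (sin_max _)) _.
    by rewrite mulr_ge0// normal_pdf_ge0.
  apply: le_trans (abs_normal_pdf_le x s0) _.
  rewrite ler_wpM2l ?mulr_ge0 ?(ltW s0)// normal_pdf_ub//.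
  by rewrite mulf_neq0.
have := Rintegral_derive_eq0 dU cu iu Ub.
rewrite /u RintegralB//; last 2 first.
  exact: (integrableZl measurableT t ic).
  exact: (integrableZl measurableT _ is_).
rewrite !RintegralZl// => /subr0_eq /(congr1 ( *%R (s ^+ 2))).
rewrite mulVKf ?expf_neq0// => <-.
by rewrite mulrA.
Qed.

(** By [normal_cos_by_parts] the function F = normal_cos s a solves
    F' t = - s^2 t F t, and F 0 = cos a. *)
Lemma normal_cosE s a (t : R) : 0 < s -> normal_cos s a t = cos a * expR (- (s * t) ^+ 2 / 2).
Proof.
move=> s0; have sn0 : s != 0 by rewrite gt_eqF.
have d (t1 : R) : is_derive t1 1 (normal_cos s a) (- (s ^+ 2 * t1 * normal_cos s a t1)).
  pose f (t x : R) := cos (t * x + a) * normal_pdf 0 s x.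
  have df (t2 x : R) : is_derive t2 1 (f ^~ x) (- (x * sin (t2 * x + a) * normal_pdf 0 s x)).
    by rewrite /f; apply: is_derive_eq; rewrite /GRing.scale/=; ring.
  have d1 (t2 x : R) : partial1of2 f t2 x = - (x * sin (t2 * x + a) * normal_pdf 0 s x).
    by rewrite partial1of2E derive_val.
  have t1I : `](t1 - 1), (t1 + 1)[%classic t1 by rewrite /= in_itv/= ltrBlDr !ltrDl !ltr01.
  have h1 (t2 : R) : `](t1 - 1), (t1 + 1)[%classic t2 -> leb.-integrable setT (EFin \o f t2).
    move=> _; apply: (@integrable_bounded_normal_pdf s _ 1) => //; last by move=> x; exact: cos_max.
    by exact: measurable_cos_affine.
  have h2 (t2 y : R) : `](t1 - 1), (t1 + 1)[%classic t2 -> setT y -> derivable (f ^~ y) t2 1.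
    by move=> _ _; exact: ex_derive.
  have h3 (y : R) : 0 <= `|y| * normal_pdf 0 s y by rewrite mulr_ge0// normal_pdf_ge0.
  have h4 : leb.-integrable setT (EFin \o (fun y => `|y| * normal_pdf 0 s y)).
    by apply: integrable_sublinear_normal_pdf => // x; rewrite normr_id.
  have h5 (t2 y : R) : `](t1 - 1), (t1 + 1)[%classic t2 -> setT y ->
      `|partial1of2 f t2 y| <= `|y| * normal_pdf 0 s y.
    move=> _ _; rewrite d1 normrN !normrM (ger0_norm (normal_pdf_ge0 _ _ _)).
    by rewrite ler_wpM2r ?normal_pdf_ge0// ler_piMr// sin_max.
  have hd := @derivable_under_integral R _ _ leb f setT measurableT t1 _ _ t1I h1 h2 _ h3 h4 h5.
  apply: DeriveDef; first exact: hd.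
  rewrite -derive1E (differentiation_under_integral measurableT t1I h1 h2 h3 h4 h5).
  under eq_Rintegral do rewrite d1 -mulN1r.
  rewrite RintegralZl//; first by rewrite mulN1r normal_cos_by_parts.
  apply: integrable_sublinear_normal_pdf => //.
    by apply: measurable_funM => //; exact: measurable_sin_affine.
  by move=> x; rewrite normrM ler_piMr// sin_max.
have dG (t1 : R) : is_derive t1 1 (fun t => normal_cos s a t * expR ((s * t) ^+ 2 / 2)) 0.
  have := d t1 => dd.
  apply: is_derive_eq.
  by rewrite /GRing.scale/=; field.
have := is_derive_0_is_cst t 0 dG.
rewrite mulr0 expr0n/= mul0r expR0 mulr1.
have -> : normal_cos s a 0 = cos a.
  rewrite /normal_cos; under eq_Rintegral do rewrite mul0r add0r.
  rewrite RintegralZl//; last exact: integrable_normal_pdf.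
  by rewrite /Rintegral integral_normal_pdf mulr1.
move=> /(congr1 ( *%R^~ (expR (- ((s * t) ^+ 2 / 2))))) /=.
by rewrite -mulrA -expRD subrr expR0 mulr1 mulNr.
Qed.

End gaussian.

Section normal_law.
Context d (T : measurableType d) {R : realType} (P : probability T R).

Lemma integral_law d' (Y : measurableType d') (X : T -> Y)
    (nu : {measure set Y -> \bar R}) (f : Y -> R) :
  measurable_fun setT X -> measurable_fun setT f ->
  P.-integrable setT (EFin \o (f \o X)) ->
  (forall B : set Y, measurable B -> P (X @^-1` B) = nu B) ->
  (\int[P]_w (f (X w))%:E = \int[nu]_x (f x)%:E)%E.
Proof.
move=> mX mf fi lawX; have mEf := (measurable_EFinP _ _).2 mf.
rewrite -(integral_pushforward mX mEf fi measurableT).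
by apply: eq_measure_integral => B mB _; exact: lawX.
Qed.

Lemma normal_law_cos (X : T -> R) (v a : R) : measurable_fun setT X -> 0 <= v ->
  (forall B : set R, measurable B -> P (X @^-1` B) = normal_law 0 v B) ->
  \int[P]_w cos (X w + a) = cos a * expR (- v / 2).
Proof.
move=> mX v0 lawX.
have mcos : measurable_fun setT (fun x : R => cos (x + a)).
  have := @measurable_cos_affine R a 1.
  by under eq_fun do rewrite mul1r.
have icos : P.-integrable setT (EFin \o (fun w => cos (X w + a))).
  apply: (le_integrable measurableT (g := EFin \o cst 1)) => //.
  - apply/measurable_EFinP; exact: (measurableT_comp mcos mX).
  - by move=> x _; rewrite lee_fin normr1 cos_max.
  - exact: finite_measure_integrable_cst.
rewrite /Rintegral.
have [v00|vn0] := eqVneq v 0.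
  rewrite (@integral_law _ _ X (\d_(0:R)) (fun x => cos (x + a)))// => [|B mB].
    by rewrite integral_dirac//; [rewrite diracT mul1e add0r v00 oppr0 mul0r expR0 mulr1|exact/measurable_EFinP].
  by rewrite lawX// /normal_law v00 eqxx.
have s0 : 0 < Num.sqrt v by rewrite sqrtr_gt0 lt_neqAle eq_sym vn0.
rewrite (@integral_law _ (measurableTypeR R) X (normal_prob 0 (Num.sqrt v)) (fun x => cos (x + a)))// => [|B mB].
  rewrite (@Rintegral_normal_prob _ _ _ 1) ?gt_eqF//; last by move=> x; exact: cos_max.
  have := @normal_cosE R (Num.sqrt v) a 1 s0.
  rewrite /normal_cos /Rintegral; under eq_integral do rewrite mul1r.
  by rewrite mulr1 sqr_sqrtr// => ->.
by rewrite lawX// /normal_law (negbTE vn0).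
Qed.
End normal_law.

(** * Lebesgue measure on the line, and Riesz representation *)

Section lebesgue_line.
Context {R : realType}.
Local Notation leb := (@lebesgue_measure R).

(** Lebesgue measure is determined by the lengths of the intervals; translations
    and reflections are the instances used below. *)
Lemma lebesgue_measure_pushforward (f : measurableTypeR R -> measurableTypeR R) :
  measurable_fun setT f ->
  (forall a b, a <= b -> leb (f @^-1` `]a, b]) = (b - a)%:E) ->
  forall A, measurable A -> leb (f @^-1` A) = leb A.
Proof.
move=> mf fab A mA; apply/esym.
pose nu := measure_function_pushforward__canonical__measure_function_Measure leb mf.
apply: (@lebesgue_measure_unique R nu) => // _ [[a b] ab <-] /=.
rewrite /pushforward.
have [ab'|ba] := leP a b.
  by rewrite fab// lebesgue_measure_itv/= lte_fin; case: ltgtP ab' => // -> _; rewrite subrr.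
by rewrite set_itv_ge ?preimage_set0 ?measure0// bnd_simp -leNgt ltW.
Qed.

Lemma Rintegral_preserving (f : measurableTypeR R -> measurableTypeR R)
    (D : set (measurableTypeR R)) (g : R -> R) :
  measurable_fun setT f ->
  (forall a b, a <= b -> leb (f @^-1` `]a, b]) = (b - a)%:E) ->
  measurable D -> leb.-integrable D (EFin \o g) ->
  leb.-integrable (f @^-1` D) (EFin \o (g \o f)) /\
  \int[leb]_(x in f @^-1` D) g (f x) = \int[leb]_(x in D) g x.
Proof.
move=> mf fab mD ig.
have eqm := lebesgue_measure_pushforward mf fab.
pose nu := measure_function_pushforward__canonical__measure_function_Measure leb mf.
have mfD : measurable (f @^-1` D) by rewrite -[X in measurable X]setTI; exact: (mf measurableT _ mD).
pose h := (EFin \o g) \_ D.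
have ih : leb.-integrable setT h by apply/(integrable_mkcond _ mD).
have mh : measurable_fun setT h by exact: (measurable_int leb).
have ihf : leb.-integrable setT (h \o f).
  apply/integrableP; split; first exact: measurableT_comp.
  have /integrableP[_] := ih.
  rewrite (@eq_measure_integral _ _ _ setT nu) => [|B mB _]; last exact/esym/eqm.
  rewrite ge0_integral_pushforward//.
  by apply: measurableT_comp.
have hf : (h \o f) = (EFin \o (g \o f)) \_ (f @^-1` D) by [].
split; first by apply/(integrable_mkcond _ mfD); rewrite -hf.
rewrite /Rintegral; congr fine.
rewrite integral_mkcond -/(EFin \o (g \o f)) -hf.
rewrite [RHS]integral_mkcond [RHS](@eq_measure_integral _ _ _ setT nu) => [|B mB _]; last exact/esym/eqm.
by rewrite integral_pushforward.
Qed.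

Lemma Rintegral_shift (a : R) (D : set R) (g : R -> R) :
  measurable D -> leb.-integrable D (EFin \o g) ->
  leb.-integrable ((fun x => x + a) @^-1` D) (EFin \o (fun x => g (x + a))) /\
  \int[leb]_(x in (fun x => x + a) @^-1` D) g (x + a) = \int[leb]_(x in D) g x.
Proof.
move=> mD ig; apply: (@Rintegral_preserving (fun x => x + a)) => // [|c b cb].
  exact: measurable_funD.
rewrite (_ : _ @^-1` _ = `]c - a, b - a]%classic); last first.
  by apply/seteqP; split => x /=; rewrite !in_itv/= ltrBlDr lerBrDr.
rewrite lebesgue_measure_itv/= lte_fin ltrD2r.
by case: ltgtP cb => // [cb _|-> _]; rewrite ?subrr// -EFinD; congr EFin; ring.
Qed.

Lemma Rintegral_reflect (a : R) (D : set R) (g : R -> R) :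
  measurable D -> leb.-integrable D (EFin \o g) ->
  leb.-integrable ((fun x => a - x) @^-1` D) (EFin \o (fun x => g (a - x))) /\
  \int[leb]_(x in (fun x => a - x) @^-1` D) g (a - x) = \int[leb]_(x in D) g x.
Proof.
move=> mD ig; apply: (@Rintegral_preserving (fun x => a - x)) => // [|c b cb].
  exact: measurable_funB.
rewrite (_ : _ @^-1` _ = `[a - b, a - c[%classic); last first.
  by apply/seteqP; split => x /=; rewrite !in_itv/=; lra.
rewrite lebesgue_measure_itv/= lte_fin ltrD2l ltrN2.
by case: ltgtP cb => // [cb _|-> _]; rewrite ?subrr// -EFinD; congr EFin; ring.
Qed.
Lemma Rintegral_cst_itv (t c : R) : 0 <= t -> \int[leb]_(s in `[0, t]) c = t * c.
Proof.
move=> t0.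
have E : fine (leb `[0, t]%classic) = t.
  rewrite lebesgue_measure_itv/= lte_fin.
  by case: ifPn => [_|]; rewrite /= ?subr0// -leNgt => t0'; exact: le_anti (introT andP (conj t0 t0')).
rewrite Rintegral_cst; last exact: measurable_itv.
by rewrite mulrC; congr (_ * _); exact: E.
Qed.

Lemma integrable_cst_itv (t c : R) : leb.-integrable `[0, t] (EFin \o cst c).
Proof.
apply: continuous_compact_integrable; first exact: segment_compact.
by apply: continuous_subspaceT => x; exact: cvg_cst.
Qed.

Lemma Rintegral_le_itv (t c : R) (g : R -> R) : 0 <= t ->
  leb.-integrable `[0, t] (EFin \o g) ->
  (forall s, 0 <= s <= t -> `|g s| <= c) -> `|\int[leb]_(s in `[0, t]) g s| <= t * c.
Proof.
move=> t0 ig gc.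
apply: le_trans (le_normr_Rintegral _ ig) _; first exact: measurable_itv.
rewrite -Rintegral_cst_itv//; apply: le_Rintegral => //.
- exact: integrable_norm.
- exact: integrable_cst_itv.
Qed.

Lemma Rintegral_itv_add (t r : R) (g : R -> R) : 0 <= t -> 0 <= r ->
  leb.-integrable `[0, t + r] (EFin \o g) ->
  \int[leb]_(s in `[0, t + r]) g s =
  \int[leb]_(s in `[0, t]) g s + \int[leb]_(s in `[0, r]) g (s + t).
Proof.
move=> t0 r0 ig.
have := @Rintegral_itvB R g _ _ t ig; rewrite !bnd_simp lerDl => /(_ t0 r0) /eqP.
have ig' : leb.-integrable `]t, (t + r)] (EFin \o g).
  by apply: integrableS ig => //; apply: subset_itvr; rewrite bnd_simp.
have ig2 : leb.-integrable `[t, (t + r)] (EFin \o g).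
  by apply: integrableS ig => //; apply: subset_itvr; rewrite bnd_simp.
rewrite Rintegral_itv_obnd_cbnd// subr_eq => /eqP ->; rewrite [LHS]addrC; congr (_ + _).
have [_ E] := @Rintegral_shift t `[t, (t + r)]%classic g (measurable_itv _) ig2.
apply: etrans (esym E) _.
congr (Rintegral _ _ _); apply/seteqP; split=> x /=; rewrite !in_itv/=; lra.
Qed.

End lebesgue_line.

Section hilbert.
Context {R : realType} (H : completeNormedModType R) (ip : {dot H for idfun}).
Hypothesis hH : is_hilbert ip.
Implicit Types x y z : H.

Lemma ipC x y : ip x y = ip y x.
Proof. by rewrite (hermC ip x y) expr0 mul1r. Qed.
Lemma ipDl x y z : ip (x + y) z = ip x z + ip y z.
Proof. exact: linearDl. Qed.
Lemma ipDr x y z : ip z (x + y) = ip z x + ip z y.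
Proof. by rewrite ipC ipDl !(ipC z). Qed.
Lemma ipNl x z : ip (- x) z = - ip x z.
Proof. exact: linearNl. Qed.
Lemma ipNr x z : ip z (- x) = - ip z x.
Proof. by rewrite ipC ipNl (ipC z). Qed.
Lemma ipBl x y z : ip (x - y) z = ip x z - ip y z.
Proof. by rewrite ipDl ipNl. Qed.
Lemma ipBr x y z : ip z (x - y) = ip z x - ip z y.
Proof. by rewrite ipDr ipNr. Qed.
Lemma ipZl a x z : ip (a *: x) z = a * ip x z.
Proof. exact: linearZl_LR. Qed.
Lemma ipZr a x z : ip z (a *: x) = a * ip z x.
Proof. by rewrite ipC ipZl (ipC z). Qed.
Lemma ip0l z : ip 0 z = 0.
Proof. by rewrite -(scale0r 0) ipZl mul0r. Qed.
Lemma ip0r z : ip z 0 = 0.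
Proof. by rewrite ipC ip0l. Qed.

Lemma ip_suml (I : Type) (r : seq I) (F : I -> H) y :
  ip (\sum_(i <- r) F i) y = \sum_(i <- r) ip (F i) y.
Proof. by elim: r => [|i r IH]; rewrite ?big_nil ?ip0l// !big_cons ipDl IH. Qed.

Lemma ip_sumr (I : Type) (r : seq I) (F : I -> H) y :
  ip y (\sum_(i <- r) F i) = \sum_(i <- r) ip y (F i).
Proof. by rewrite ipC ip_suml; apply: eq_bigr => i _; exact: ipC. Qed.

Lemma ip_ge0 x : 0 <= ip x x.
Proof. by rewrite -hH sqr_ge0. Qed.

Lemma ip_ext x y : (forall z, ip x z = ip y z) -> x = y.
Proof.
move=> xy; apply/eqP; rewrite -subr_eq0 -normr_eq0 -sqrf_eq0 hH.
by rewrite ipBl xy subrr.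
Qed.

Lemma normD_sqr x y : `|x + y| ^+ 2 = `|x| ^+ 2 + ip x y *+ 2 + `|y| ^+ 2.
Proof. by rewrite !hH ipDl !ipDr (ipC y x) mulr2n; ring. Qed.

Lemma cauchy_schwarz x y : `|ip x y| <= `|x| * `|y|.
Proof.
have [->|y0] := eqVneq y 0; first by rewrite ip0r normr0 mulr_ge0.
have y2 : 0 < `|y| ^+ 2 by rewrite exprn_gt0// normr_gt0.
rewrite -ler_sqr ?nnegrE ?mulr_ge0// real_normK ?num_real// exprMn.
have : ip (`|y| ^+ 2 *: x - ip x y *: y) (`|y| ^+ 2 *: x - ip x y *: y) =
    `|y| ^+ 2 * (`|x| ^+ 2 * `|y| ^+ 2 - ip x y ^+ 2).
  by rewrite !ipBl !ipBr !ipZl !ipZr (ipC y x) -!hH; ring.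
by move=> E; have := ip_ge0 (`|y| ^+ 2 *: x - ip x y *: y); rewrite E pmulr_rge0// subr_ge0.
Qed.

Lemma continuous_op_bounded (T : {linear H -> H}) : continuous T ->
  exists2 C, 0 < C & forall x, `|T x| <= C * `|x|.
Proof.
move=> /linear_bounded_continuous/linear_boundedP nT.
near +oo_R => C; exists C; first by near: C; exact: nbhs_pinfty_gt.
by near: C.
Unshelve. all: by end_near.
Qed.

Lemma ip_cvgl {I : Type} (F : set_system I) {FF : Filter F} (u : I -> H) (l y : H) :
  u @ F --> l -> ip (u i) y @[i --> F] --> ip l y.
Proof.
move=> Fl; apply/cvgrPdist_le => e e0.
have e1 : 0 < e / (`|y| + 1) by rewrite divr_gt0// ltr_wpDl.
move/cvgrPdist_le : Fl => /(_ _ e1); apply: filterS => z lz.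
rewrite -ipBl (le_trans (cauchy_schwarz _ _))//.
have := ler_wpM2r (normr_ge0 y) lz.
move=> /le_trans; apply; rewrite mulrAC ler_pdivrMr ?ltr_wpDl//.
by rewrite ler_wpM2l ?(ltW e0)// lerDl.
Qed.

(** Minimise J x = |x|^2 / 2 - f x. By the parallelogram identity a minimising
    sequence is Cauchy, and the first order condition at its limit z is f = <z, .>. *)
Lemma riesz (f : H -> R) (C : R) : (forall a x y, f (a *: x + y) = a * f x + f y) ->
  (forall x, `|f x| <= C * `|x|) -> exists z, forall x, f x = ip x z.
Proof.
move=> fl fC.
have f0 : f 0 = 0 by have := fl 1 0 0; rewrite scaler0 addr0 mul1r; lra.
have fD x y : f (x + y) = f x + f y by rewrite -{1}(scale1r x) fl mul1r.
have fZ a x : f (a *: x) = a * f x by rewrite -{1}(addr0 (a *: x)) fl f0 addr0.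
pose J x := `|x| ^+ 2 / 2 - f x.
have Jge x : - C ^+ 2 / 2 <= J x.
  rewrite /J; have := fC x; have := ler_norm (f x) => h1 h2.
  have := sqr_ge0 (`|x| - C); lra.
pose m := inf (range J).
have hinf : has_inf (range J).
  by split; [exists (J 0); exists 0|exists (- C ^+ 2 / 2) => _ [x _ <-]].
have mJ x : m <= J x by apply: (inf_lbound hinf.2); exists x.
have ex n : exists x, J x < m + harmonic n.
  have [_ [x _ <-] ?] := @inf_adherent _ (range J) (harmonic n) (harmonic_gt0 _) hinf.
  by exists x.
have [u uP] := choice ex.
have J2 x y : `|x - y| ^+ 2 = 4 * (J x + J y - 2 * J (2^-1 *: (x + y))).
  rewrite /J fZ fD normrZ ger0_norm// exprMn !normD_sqr ipNr normrN !mulr2n; by field.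
have uC n k : `|u n - u k| ^+ 2 <= 4 * (harmonic n + harmonic k).
  rewrite J2; have := uP n; have := uP k; have := mJ (2^-1 *: (u n + u k)); lra.
have cu : cvg (u @ \oo).
  apply/cauchy_cvgP.
  apply: cauchy_exP => e e0.
  have [N _ NP] : \forall n \near \oo, (harmonic n : R) < e ^+ 2 / 16.
    have e2 : 0 < e ^+ 2 / 16 by rewrite divr_gt0 ?exprn_gt0.
    by have /cvgr0_norm_lt/(_ _ e2) := @cvg_harmonic R; apply: filterS => n /ltr_normlP[].
  exists (u N); exists N => // n /= Nn; rewrite -ball_normE /=.
  rewrite -ltr_sqr ?nnegrE ?(ltW e0)//.
  apply: le_lt_trans (uC _ _) _.
  have h1 : harmonic N < e ^+ 2 / 16 := NP N (leqnn N).
  have h2 : harmonic n < e ^+ 2 / 16 := NP n Nn.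
  have h3 : 0 < e ^+ 2 by rewrite exprn_gt0.
  by move: (harmonic N) (harmonic n) h1 h2 => a b h1 h2; lra.
have uz : u @ \oo --> lim (u @ \oo) by [].
set z := lim (u @ \oo) in uz; exists z => x; rewrite (ipC x z).
have opt (t : R) : 0 <= t * (ip z x - f x) + t ^+ 2 * (`|x| ^+ 2 / 2).
  have c : harmonic n + (t * (ip (u n) x - f x) + t ^+ 2 * (`|x| ^+ 2 / 2)) @[n --> \oo] -->
      0 + (t * (ip z x - f x) + t ^+ 2 * (`|x| ^+ 2 / 2)).
    apply: cvgD; first exact: cvg_harmonic.
    apply: cvgD; last exact: cvg_cst.
    apply: cvgMr; apply: cvgB; last exact: cvg_cst.
    exact: ip_cvgl.
  rewrite -[leRHS]add0r -(cvg_lim _ c)//; apply: limr_ge; first exact: cvgP c.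
  apply: nearW => n; have := mJ (u n + t *: x); have := uP n.
  rewrite /J normD_sqr fD fZ normrZ exprMn real_normK ?num_real// ipZr.
  lra.
have b0 : 0 <= `|x| ^+ 2 / 2 by rewrite divr_ge0// sqr_ge0.
move: (`|x| ^+ 2 / 2) b0 opt => b b0.
(* The quadratic t a + t^2 b is negative at t = - a / (b + 1), unless a = 0. *)
move=> /(_ (- (ip z x - f x) / (b + 1))).
set a := ip z x - f x => opt.
have b1 : 0 < b + 1 by rewrite ltr_wpDl.
have : - a / (b + 1) * a + (- a / (b + 1)) ^+ 2 * b = - (a / (b + 1)) ^+ 2.
  by field; lra.
move=> E; rewrite E oppr_ge0 in opt.
have /eqP : (a / (b + 1)) ^+ 2 == 0 by rewrite eq_le opt sqr_ge0.
move/eqP; rewrite sqrf_eq0 mulf_eq0 invr_eq0 (gt_eqF b1) orbF subr_eq0.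
by move=> /eqP <-.
Qed.

Lemma adjP (T : {linear H -> H}) : continuous T ->
  forall x y, ip (T x) y = ip x (adj ip setT T y).
Proof.
move=> /continuous_op_bounded[C C0 TC] x y.
have [||z zP] := @riesz (fun x => ip (T x) y) (C * `|y|).
- by move=> a u v; rewrite linearP ipDl ipZl.
- move=> u; rewrite (le_trans (cauchy_schwarz _ _))// mulrAC.
  by rewrite ler_wpM2r.
have := @xgetPex _ 0 [set z | forall x, setT x -> ip (T x) y = ip x z].
by apply; [exists z => u _; exact: zP|].
Qed.

Lemma adj_le (T : {linear H -> H}) (C : R) : continuous T ->
  (forall x, `|T x| <= C * `|x|) -> forall y, `|adj ip setT T y| <= C * `|y|.
Proof.
move=> cT TC y; set a := adj _ _ _ _.
have [->|a0] := eqVneq a 0.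
  rewrite normr0; have := TC y; have [->|y0] := eqVneq y 0; first by rewrite normr0 mulr0.
  move=> h; exact: le_trans h.
have : `|a| ^+ 2 <= `|a| * (C * `|y|).
  rewrite hH -adjP// (le_trans (ler_norm _))// (le_trans (cauchy_schwarz _ _))//.
  by rewrite mulrA [_ * C]mulrC ler_wpM2r.
by rewrite expr2 ler_pM2l// normr_gt0.
Qed.

End hilbert.

(** * The integrated semigroup *)

Section semigroup.
Context {R : realType} (H : completeNormedModType R) (ip : {dot H for idfun}).
Hypothesis hH : is_hilbert ip.
Variable S : R -> {linear H -> H}.
Hypothesis hS : C0_semigroup S.
Implicit Types (x y z : H) (s t r : R).
Local Notation leb := (@lebesgue_measure R).
Local Notation Sa := (Sadj ip S).

Lemma semigroup_op_continuous t : 0 <= t -> continuous (S t). Proof. by case: hS => h *; exact: h. Qed.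
Lemma semigroup0 x : S 0 x = x. Proof. by case: hS. Qed.
Lemma semigroupD s t x : 0 <= s -> 0 <= t -> S (s + t) x = S s (S t x).
Proof. by case: hS => _ _ h _; exact: h. Qed.

Lemma semigroup_near0 x e : 0 < e -> exists2 d, 0 < d & forall s, 0 <= s < d -> `|S s x - x| < e.
Proof.
case: hS => _ _ _ /(_ x)/cvgrPdist_lt c e0.
have [d /= d0 dP] := c _ e0; exists d => // s /andP[].
rewrite le_eqVlt => /predU1P[<- _|s0 sd]; first by rewrite semigroup0 subrr normr0.
by rewrite distrC; apply: dP => //=; rewrite sub0r normrN gtr0_norm.
Qed.

(** Otherwise there are s_n -> 0 such that S(s_n) has norm more than n + 1, although
    S(s_n) x -> x is bounded for every x: this contradicts the uniform boundedness
    principle. *)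
Lemma semigroup_bounded_near0 : exists2 d, 0 < d & exists2 M, 1 <= M &
  forall s, 0 <= s <= d -> forall x, `|S s x| <= M * `|x|.
Proof.
apply: contrapT => contra.
have ex n : exists s, 0 <= s <= harmonic n /\ exists x, n.+1%:R * `|x| < `|S s x|.
  apply: contrapT => nex; apply: contra; exists (harmonic n); first exact: harmonic_gt0.
  exists n.+1%:R; first by rewrite ler1n.
  move=> s sn x; rewrite leNgt; apply/negP => lt; apply: nex; exists s; split=> //.
  by exists x.
have [s sP] := choice ex.
pose F : set (H -> H) := [set (S (s n) : H -> H) | n in setT].
have s0 n : 0 <= s n by have [/andP[]] := sP n.
have FB f : F f -> bounded_fun_norm f /\ linear f.
  move=> [n _ <-]; split; last by move=> a x y; rewrite linearP.
  have [C C0 SC] := continuous_op_bounded (semigroup_op_continuous (s0 n)).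
  move=> r; exists (C * r) => x xr; apply: le_trans (SC x) _.
  by rewrite ler_wpM2l// ltW.
have Fp : pointwise_bounded F.
  move=> x.
  have c : S (s n) x @[n --> \oo] --> x.
    apply/cvgrPdist_lt => e e0; have [d d0 dP] := semigroup_near0 x e0.
    have /cvgr0_norm_lt/(_ _ d0) := @cvg_harmonic R; apply: filterS => n /ltr_normlP[_ nd].
    rewrite distrC; apply: dP; have [/andP[-> sn] _] := sP n.
    exact: le_lt_trans sn nd.
  have /cvg_seq_bounded[M [_ MP]] := cvgP _ c.
  exists (M + 1) => f [n _ <-]; apply: MP => //; by rewrite ltrDl.
have [M MP] := Banach_Steinhauss FB Fp 1.
have [n Mn] : exists n, M < n.+1%:R.
  by exists (Num.truncn M); exact: truncnS_gt.
have [_ [x xP]] := sP n.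
have x0 : x != 0.
  by apply/eqP => x0; move: xP; rewrite x0 linear0 normr0 mulr0 ltxx.
have nx : 0 < `|x| by rewrite normr_gt0.
have := MP (S (s n)) (ex_intro2 _ _ n I erefl) (`|x|^-1 *: x).
rewrite normrZ ger0_norm ?invr_ge0// mulVf ?normr_eq0// => /(_ (lexx _)).
rewrite linearZ/= normrZ ger0_norm ?invr_ge0// ler_pdivrMl// => /(lt_le_trans xP).
by rewrite mulrC ltr_pM2l// => /(lt_trans Mn); rewrite ltxx.
Qed.

(** By the semigroup law, with as many steps as needed of the length given by
    [semigroup_bounded_near0]. *)
Lemma semigroup_locally_bounded t : exists2 M, 0 < M & forall s, 0 <= s <= t -> forall x, `|S s x| <= M * `|x|.
Proof.
have [d d0 [M M1 MP]] := semigroup_bounded_near0.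
have [n tn] : exists n, t <= n%:R * d.
  exists (Num.truncn (t / d)).+1; rewrite -ler_pdivrMr//; exact/ltW/truncnS_gt.
exists (M ^+ n); first by rewrite exprn_gt0// (lt_le_trans ltr01).
elim: n t tn => [|n IH] t tn s /andP[s0 st] x.
  have -> : s = 0 by apply/eqP; rewrite eq_le s0 andbT (le_trans st)// (le_trans tn)// mul0r.
  by rewrite semigroup0 expr0 mul1r.
have [sd|ds] := leP s d.
  apply: le_trans (MP s _ x) _; first by rewrite s0.
  by rewrite ler_wpM2r// exprS ler_peMr ?exprn_ege1// (le_trans ler01).
rewrite -(subrK d s) semigroupD ?subr_ge0 ?(ltW ds)// ?(ltW d0)//.
apply: le_trans (IH (n%:R * d) (lexx _) (s - d) _ _) _.
  rewrite subr_ge0 (ltW ds)/= lerBlDr (le_trans st)// (le_trans tn)//.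
  by rewrite -[n.+1]addn1 natrD mulrDl mul1r.
rewrite exprS mulrC [M * _]mulrC -mulrA [leLHS]mulrC ler_wpM2l ?exprn_ge0 ?(le_trans ler01)//.
by apply: MP; rewrite (ltW d0) lexx.
Qed.

(** The absolute value extends the orbit to the whole line, so that the results on
    continuous real functions apply to it without restriction to a half-line. *)
Lemma orbit_continuous x : continuous (fun t : R => S `|t| x).
Proof.
move=> t; apply/cvgrPdist_lt => e e0.
have [M M0 MP] := semigroup_locally_bounded (`|t| + 1).
have e1 : 0 < e / M by rewrite divr_gt0.
have [d d0 dP] := semigroup_near0 x e1.
have md : 0 < Num.min d 1 by rewrite lt_min d0 ltr01.
exists (Num.min d 1) => //= s; rewrite /ball_/= lt_min => /andP[sd s1].
have key (a b : R) : 0 <= a -> a <= b -> b - a < d -> a <= `|t| + 1 -> `|S b x - S a x| < e.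
  move=> a0 ab abd at1.
  have -> : S b x = S a (S (b - a) x) by rewrite -semigroupD ?subr_ge0// addrC subrK.
  rewrite -linearB (le_lt_trans (MP _ _ _)) ?a0//.
  rewrite -ltr_pdivlMl// mulrC; apply: dP; by rewrite subr_ge0 ab.
have ts : `| `|t| - `|s| | <= `|t - s| by exact: ler_dist_dist.
have /ler_normlP[h1 h2] := ts.
have [l|/ltW l] := leP `|t| `|s|.
  rewrite distrC; apply: key => //; lra.
apply: key => //; lra.
Qed.

Lemma orbit_integrable t x y : leb.-integrable `[0, t] (EFin \o (fun s => ip (S s x) y)).
Proof.
have c : continuous (fun s : R => ip (S `|s| x) y).
  by move=> s; apply: ip_cvgl => //; exact: orbit_continuous.
have : leb.-integrable `[0, t] (EFin \o (fun s : R => ip (S `|s| x) y)).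
  apply: continuous_compact_integrable; first exact: segment_compact.
  exact: continuous_subspaceT.
apply: eq_integrable => // s; rewrite inE/= in_itv/= => /andP[s0 _].
by rewrite ger0_norm.
Qed.


(** The coordinate integrals form a bounded functional, which is represented by a
    vector. *)
Lemma vintegralP (D : set R) (f : R -> H) (C : R) :
  measurable D ->
  (forall h, leb.-integrable D (EFin \o (fun s => ip (f s) h))) ->
  (forall h, `|\int[leb]_(s in D) ip (f s) h| <= C * `|h|) ->
  forall h, ip (vintegral ip D f) h = \int[leb]_(s in D) ip (f s) h.
Proof.
move=> mD fi fb h.
have [||z zP] := @riesz _ _ ip hH (fun h => \int[leb]_(s in D) ip (f s) h) C => //.
  move=> a x y; rewrite -Rintegral_linear//.
  by apply: eq_Rintegral => s _; rewrite ipDr ipZr.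
have ex : exists y, [set y | forall h,
    leb.-integrable D (fun s => (ip (f s) h)%:E) /\
    ip y h = \int[leb]_(s in D) ip (f s) h] y.
  by exists z => k; split; [exact: fi|rewrite zP (ipC ip z)].
by have [_] := xgetPex 0 ex h.
Qed.

(** The operator V_t x = int_0^t S(s) x ds. Its values lie in the domain of the
    generator A and A V_t x = S(t) x - x, so that it does the work of the
    differentiability of the orbits. *)
Definition integrated t x : H := vintegral ip `[0, t] (fun s => S s x).
Local Notation V := integrated.

Lemma integratedE t x y : 0 <= t -> ip (V t x) y = \int[leb]_(s in `[0, t]) ip (S s x) y.
Proof.
move=> t0; have [M M0 MP] := semigroup_locally_bounded t.
apply: (@vintegralP _ _ (t * (M * `|x|))) => [//|h|h]; first exact: orbit_integrable.
rewrite -mulrA; apply: Rintegral_le_itv => // [|s st]; first exact: orbit_integrable.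
by rewrite (le_trans (cauchy_schwarz hH _ _))// ler_wpM2r// MP.
Qed.

(** Test on k = w. *)
Lemma norm_weak_le w c : 0 <= c -> (forall k, ip w k <= c * `|k|) -> `|w| <= c.
Proof.
move=> c0 wc; have [->|w0] := eqVneq w 0; first by rewrite normr0.
by have := wc w; rewrite -hH expr2 ler_pM2r// normr_gt0.
Qed.

Lemma integrated_near_weak t x k (e : R) : 0 <= t ->
  (forall s, 0 <= s <= t -> `|ip (S s x - x) k| <= e) ->
  `|ip (V t x - t *: x) k| <= t * e.
Proof.
move=> t0 Se.
have ic := integrable_cst_itv t (ip x k).
have iS := orbit_integrable t x k.
have -> : ip (V t x - t *: x) k = \int[leb]_(s in `[0, t]) (ip (S s x) k - ip x k).
  by rewrite RintegralB// ipBl integratedE// ipZl Rintegral_cst_itv.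
apply: Rintegral_le_itv => // [|s st]; first exact: integrable_sub.
by rewrite -ipBl Se.
Qed.

Lemma integrated_near t x e : 0 <= t -> 0 <= e -> (forall s, 0 <= s <= t -> `|S s x - x| <= e) ->
  `|V t x - t *: x| <= t * e.
Proof.
move=> t0 e0 Se; apply: norm_weak_le => [|k]; first by rewrite mulr_ge0.
apply: le_trans (ler_norm _) _; rewrite -mulrA; apply: integrated_near_weak => // s st.
by rewrite (le_trans (cauchy_schwarz hH _ _))// ler_wpM2r// Se.
Qed.

(** V_t x / t is the mean of S(s) x over [0, t]. *)
Lemma integrated_average_near x e : 0 < e -> exists2 d, 0 < d & forall t, 0 < t < d -> `|t^-1 *: V t x - x| <= e.
Proof.
move=> e0; have [d d0 dP] := semigroup_near0 x e0; exists d => // t /andP[t0 td].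
have h := @integrated_near t x e (ltW t0) (ltW e0).
have -> : t^-1 *: V t x - x = t^-1 *: (V t x - t *: x).
  by rewrite scalerBr scalerA mulVf ?gt_eqF// scale1r.
rewrite normrZ ger0_norm ?invr_ge0 ?(ltW t0)// ler_pdivrMl//.
by apply: h => s /andP[s0 st]; apply/ltW/dP; rewrite s0 (le_lt_trans st).
Qed.

Lemma integrated_average_cvg x : t^-1 *: V t x @[t --> 0^'+] --> x.
Proof.
apply/cvgrPdist_le => e e0; have [d d0 dP] := integrated_average_near x e0.
exists d => //= t; rewrite /ball_/= sub0r normrN => td t0; rewrite distrC.
by apply: dP; rewrite t0 (le_lt_trans (ler_norm _) td).
Qed.

Lemma integrated_linear t a x y : 0 <= t -> V t (a *: x + y) = a *: V t x + V t y.
Proof.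
move=> t0; apply: (ip_ext hH) => z; rewrite ipDl ipZl !integratedE//.
rewrite -Rintegral_linear//; [|exact: orbit_integrable..].
by apply: eq_Rintegral => s _; rewrite linearP ipDl ipZl.
Qed.

Lemma integrated_le t (M : R) x : 0 <= t -> 0 <= M ->
  (forall s, 0 <= s <= t -> forall x, `|S s x| <= M * `|x|) -> `|V t x| <= t * M * `|x|.
Proof.
move=> t0 M0 MP; apply: norm_weak_le => [|k]; first by rewrite !mulr_ge0.
rewrite integratedE//; apply: le_trans (ler_norm _) _; rewrite -!mulrA.
apply: Rintegral_le_itv => // [|s st]; first exact: orbit_integrable.
by rewrite (le_trans (cauchy_schwarz hH _ _))// mulrA ler_wpM2r// MP.
Qed.

Lemma integrated_bounded t : 0 <= t -> exists2 C, 0 < C & forall x, `|V t x| <= C * `|x|.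
Proof.
move=> t0; have [M M0 MP] := semigroup_locally_bounded t.
exists ((t + 1) * M) => [|x]; first by rewrite mulr_gt0// ltr_wpDl.
apply: le_trans (integrated_le x t0 (ltW M0) MP) _.
by rewrite !ler_wpM2r ?(ltW M0) ?lerDl.
Qed.

Lemma semigroup_integratedC r t x : 0 <= r -> 0 <= t -> S r (V t x) = V t (S r x).
Proof.
move=> r0 t0; apply: (ip_ext hH) => z; rewrite (adjP hH (semigroup_op_continuous r0)) !integratedE//.
apply: eq_Rintegral => s; rewrite inE/= in_itv/= => /andP[s0 _].
by rewrite -(adjP hH (semigroup_op_continuous r0)) -!semigroupD// addrC.
Qed.

Lemma integratedD t r x : 0 <= t -> 0 <= r -> V (t + r) x = V t x + S t (V r x).
Proof.
move=> t0 r0; apply: (ip_ext hH) => z.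
rewrite ipDl (adjP hH (semigroup_op_continuous t0)) !integratedE ?addr_ge0//.
rewrite Rintegral_itv_add//; last exact: orbit_integrable.
congr (_ + _); apply: eq_Rintegral => s; rewrite inE/= in_itv/= => /andP[s0 _].
by rewrite -(adjP hH (semigroup_op_continuous t0)) -semigroupD// addrC.
Qed.

(** Both sides are V_(t+r) x - V_t x - V_r x. *)
Lemma semigroup_integrated_sub r t x : 0 <= r -> 0 <= t -> S r (V t x) - V t x = S t (V r x) - V r x.
Proof.
move=> r0 t0; have E : V t x + S t (V r x) = V r x + S r (V t x).
  by rewrite -!integratedD// addrC.
rewrite -[S r _](addrK (V r x)) [S r _ + _]addrC -E.
by rewrite addrAC (addrC (V t x)) addrK.
Qed.

Lemma bounded_linear_cvg (T : H -> H) (C : R) (F : set_system R) {FF : Filter F} (u : R -> H) l :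
  (forall a x y, T (a *: x + y) = a *: T x + T y) -> (forall x, `|T x| <= C * `|x|) -> 0 < C ->
  u @ F --> l -> T (u t) @[t --> F] --> T l.
Proof.
move=> TL TC C0 ul; apply/cvgrPdist_le => e e0.
have /cvgrPdist_le/(_ (e / C)) := ul; rewrite divr_gt0// => /(_ isT).
apply: filterS => t h.
have -> : T l - T (u t) = T (l - u t).
  by rewrite (_ : l - u t = (-1) *: u t + l) ?TL scaleN1r addrC.
by rewrite (le_trans (TC _))// -ler_pdivlMl// mulrC.
Qed.

(** By [semigroup_integrated_sub] the difference quotient at r is S(t) - 1 applied to
    V_r x / r, which tends to x. *)
Lemma gen_integrated_cvg t x : 0 <= t -> r^-1 *: (S r (V t x) - V t x) @[r --> 0^'+] --> S t x - x.
Proof.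
move=> t0.
have h : S t (r^-1 *: V r x) - r^-1 *: V r x @[r --> 0^'+] --> S t x - x.
  apply: cvgB; last exact: integrated_average_cvg.
  have [C C0 CP] := continuous_op_bounded (semigroup_op_continuous t0).
  apply: (@bounded_linear_cvg (S t) C) => //; last exact: integrated_average_cvg.
  by move=> a u v; rewrite linearP.
apply: cvg_trans h; apply: near_eq_cvg.
near=> r; have r0 : 0 < r by [].
by rewrite semigroup_integrated_sub// ?(ltW r0)// scalerBr linearZ.
Unshelve. all: by end_near.
Qed.

Lemma gen_dom_integrated t x : 0 <= t -> gen_dom S (V t x).
Proof. by move=> t0; apply/cvg_ex; exists (S t x - x); exact: gen_integrated_cvg. Qed.

Lemma gen_integrated t x : 0 <= t -> gen S (V t x) = S t x - x.
Proof. by move=> t0; apply: cvg_lim => //; exact: gen_integrated_cvg. Qed.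

(** V_t commutes with the difference quotients (S(r) - 1) / r. Let r tend to 0, on x
    and on V_t x. *)
Lemma integrated_gen t x : 0 <= t -> gen_dom S x -> V t (gen S x) = S t x - x.
Proof.
move=> t0 dx.
have h1 : r^-1 *: (S r (V t x) - V t x) @[r --> 0^'+] --> V t (gen S x).
  have [C C0 CP] := integrated_bounded t0.
  have h : V t (r^-1 *: (S r x - x)) @[r --> 0^'+] --> V t (gen S x).
    apply: (@bounded_linear_cvg (V t) C) => //.
    by move=> a u v; rewrite integrated_linear.
  apply: cvg_trans h; apply: near_eq_cvg.
  near=> r; have r0 : 0 < r by [].
  have VZ a u : V t (a *: u) = a *: V t u.
    have V0 : V t 0 = 0.
      by apply/eqP; rewrite -normr_le0 -(mulr0 C) -[X in _ <= C * X](normr0 H) CP.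
    by rewrite -[a *: u]addr0 integrated_linear// V0 addr0.
  rewrite VZ semigroup_integratedC ?(ltW r0)//; congr (_ *: _).
  by rewrite (_ : S r x - x = (-1) *: x + S r x) ?integrated_linear// scaleN1r addrC.
rewrite -(cvg_lim _ h1)//; apply: cvg_lim => //; exact: gen_integrated_cvg.
Unshelve. all: by end_near.
Qed.

End semigroup.

(** * The adjoint semigroup and the two intertwining conditions *)

(** Cut [0, t] into n equal steps: the total increment is at most n C (t / n)^2, for
    every n. *)
Lemma quadratic_increments_constant (R : realType) (f : R -> R) (t C : R) : 0 <= t ->
  (forall s u, 0 <= s -> 0 <= u -> s + u <= t -> `|f (s + u) - f s| <= C * u ^+ 2) ->
  f t = f 0.
Proof.
move=> t0 fC; apply/eqP; rewrite -subr_eq0 -normr_le0; apply/ler_addgt0Pr => e e0.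
rewrite add0r.
have C0 : 0 <= C * t ^+ 2 by have := fC 0 t (lexx _) t0; rewrite add0r => /(_ (lexx _)); exact: le_trans.
pose n := (Num.truncn (C * t ^+ 2 / e)).+1.
have n0 : 0 < n%:R :> R by rewrite ltr0n.
have h k : (k <= n)%N -> `|f (k%:R * (t / n%:R)) - f 0| <= k%:R * (C * (t / n%:R) ^+ 2).
  elim: k => [|k IH] kn; first by rewrite !mul0r subrr normr0.
  have := IH (ltnW kn); rewrite -[k.+1]addn1 natrD mulrDl mul1r.
  have := fC (k%:R * (t / n%:R)) (t / n%:R).
  rewrite mulr_ge0 ?divr_ge0// => /(_ isT isT).
  have -> : k%:R * (t / n%:R) + t / n%:R <= t.
    have -> : k%:R * (t / n%:R) + t / n%:R = k.+1%:R * (t / n%:R) by rewrite -[k.+1]addn1 natrD mulrDl mul1r.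
    rewrite mulrCA ler_piMr// ler_pdivrMr// mul1r ler_nat//.
  move=> /(_ isT) h1 h2; rewrite mulrDl mul1r.
  rewrite -[_ - f 0](subrKA (f (k%:R * (t / n%:R)))) (le_trans (ler_normD _ _))//.
  by rewrite addrC lerD.
have := h n (leqnn n); rewrite mulrC divfK ?gt_eqF// => /le_trans; apply.
have -> : n%:R * (C * (t / n%:R) ^+ 2) = C * t ^+ 2 / n%:R by field; rewrite gt_eqF.
rewrite ler_pdivrMr// [leRHS]mulrC -ler_pdivrMr//.
exact/ltW/truncnS_gt.
Qed.

Section adjoint.
Context {R : realType} (H : completeNormedModType R) (ip : {dot H for idfun}).
Hypothesis hH : is_hilbert ip.
Variable S : R -> {linear H -> H}.
Hypothesis hS : C0_semigroup S.
Implicit Types (x y z : H) (s t r : R).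
Local Notation leb := (@lebesgue_measure R).
Local Notation Sa := (Sadj ip S).
Local Notation V := (integrated ip S).

Lemma SadjP t x y : 0 <= t -> ip (S t x) y = ip x (Sa t y).
Proof. by move=> t0; apply: adjP => //; exact: semigroup_op_continuous. Qed.

Lemma SadjPr t x y : 0 <= t -> ip (Sa t x) y = ip x (S t y).
Proof. by move=> t0; rewrite ipC -SadjP// ipC. Qed.

Lemma SadjD s t x : 0 <= s -> 0 <= t -> Sa (s + t) x = Sa s (Sa t x).
Proof.
move=> s0 t0; apply: (ip_ext hH) => z.
by rewrite !SadjPr ?addr_ge0// addrC (semigroupD hS).
Qed.

Lemma Sadj0 x : Sa 0 x = x.
Proof. by apply: (ip_ext hH) => z; rewrite SadjPr// (semigroup0 hS). Qed.

Lemma Sadj_le (M : R) t : 0 <= t -> (forall x, `|S t x| <= M * `|x|) -> forall x, `|Sa t x| <= M * `|x|.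
Proof. by move=> t0 SM; apply: adj_le => //; exact: semigroup_op_continuous. Qed.

(** The graph of A*, as a relation: it can be used before A* is known to be single
    valued. *)
Definition adj_gen x z := forall y, gen_dom S y -> ip (gen S y) x = ip y z.

Lemma adj_genP x : adj_dom ip (gen_dom S) (gen S) x ->
  adj_gen x (adj ip (gen_dom S) (gen S) x).
Proof. by move=> ex y dy; have := xgetPex 0 ex; apply. Qed.

(** Test the relation between x and z on V_t y, which lies in the domain of A. *)
Lemma adj_gen_integrated x z t y : adj_gen x z -> 0 <= t -> ip (S t y - y) x = ip (V t y) z.
Proof. by move=> xz t0; rewrite -(gen_integrated hH hS)// xz//; exact: gen_dom_integrated. Qed.

(** The domain of A* is weakly dense. For every x the vector w which represents
    y |-> <V_t y, x>, that is the weak integral of S*(s) x over [0, t], is in this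
    domain, and A* w = S*(t) x - x. Hence V_t (u - v) = 0 for t > 0, and
    V_t (u - v) / t -> u - v. *)
Lemma adj_gen_dense u v : (forall x z, adj_gen x z -> ip x u = ip x v) -> u = v.
Proof.
move=> uv; apply/eqP; rewrite -subr_eq0; apply/eqP.
have V0 t : 0 < t -> V t (u - v) = 0.
  move=> /ltW t0; apply: (ip_ext hH) => x; rewrite ip0l.
  have [C C0 VC] := integrated_bounded hH hS t0.
  have [||w wP] := @riesz _ _ ip hH (fun y => ip (V t y) x) (C * `|x|).
  - by move=> a y1 y2; rewrite integrated_linear// ipDl ipZl.
  - by move=> y; rewrite (le_trans (cauchy_schwarz hH _ _))// mulrAC ler_wpM2r.
  rewrite wP ipBl !(ipC ip _ w); apply/eqP; rewrite subr_eq0; apply/eqP.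
  apply: (uv _ (Sa t x - x)) => y dy.
  by rewrite -wP integrated_gen// ipBl SadjP// ipBr.
have := @integrated_average_cvg _ _ _ hH _ hS (u - v) => /cvg_lim <- //.
apply/cvg_lim => //; apply: cvg_near_cst; near=> t.
by rewrite V0 ?scaler0.
Unshelve. all: by end_near.
Qed.

(** Both z and z' have the products <S(t) y - y, x> with V_t y, and V_t y / t -> y. *)
Lemma adj_gen_unique x z z' : adj_gen x z -> adj_gen x z' -> z = z'.
Proof.
move=> xz xz'; apply/eqP; rewrite -subr_eq0; apply/eqP.
apply: (ip_ext hH) => y; rewrite ip0l.
have c : ip (t^-1 *: V t y) (z - z') @[t --> 0^'+] --> ip y (z - z').
  by apply: ip_cvgl => //; exact: integrated_average_cvg.
rewrite ipC -(cvg_lim _ c)//; apply/cvg_lim => //; apply: cvg_near_cst; near=> t.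
have t0 : 0 <= t by [].
by rewrite ipZl ipBr -(adj_gen_integrated _ xz)// -(adj_gen_integrated _ xz')// subrr mulr0.
Unshelve. all: by end_near.
Qed.

Lemma gen_semigroup r x : 0 <= r -> gen_dom S x -> gen_dom S (S r x) /\ gen S (S r x) = S r (gen S x).
Proof.
move=> r0 dx.
have [C C0 CP] := continuous_op_bounded (semigroup_op_continuous hS r0).
have h : S r (t^-1 *: (S t x - x)) @[t --> 0^'+] --> S r (gen S x).
  apply: (@bounded_linear_cvg _ _ (S r) C) => //.
  by move=> a u v; rewrite linearP.
have h2 : t^-1 *: (S t (S r x) - S r x) @[t --> 0^'+] --> S r (gen S x).
  apply: cvg_trans h; apply: near_eq_cvg; near=> t.
  have t0 : 0 <= t by [].
  have E : S t (S r x) = S r (S t x) by rewrite -!(semigroupD hS)// addrC.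
  by rewrite E linearZ linearB.
split; first by apply/cvg_ex; exists (S r (gen S x)).
exact: cvg_lim h2.
Unshelve. all: by end_near.
Qed.

Lemma adj_gen_Sadj r x z : 0 <= r -> adj_gen x z -> adj_gen (Sa r x) (Sa r z).
Proof.
move=> r0 xz y dy; have [d e] := gen_semigroup r0 dy.
by rewrite -!SadjP// -e xz.
Qed.

(** S*(t) x - x is the weak integral of S*(s) z over [0, t]. In particular S* is
    strongly continuous at 0 on the domain of A*. *)
Lemma Sadj_lipschitz x z t (M : R) : 0 <= t -> 0 <= M ->
  (forall s, 0 <= s <= t -> forall x, `|S s x| <= M * `|x|) ->
  adj_gen x z -> `|Sa t x - x| <= t * M * `|z|.
Proof.
move=> t0 M0 MP xz; apply: (norm_weak_le hH) => [|y]; first by rewrite !mulr_ge0.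
rewrite ipBl SadjPr// -ipBr ipC (adj_gen_integrated _ xz)//.
apply: le_trans (ler_norm _) _; apply: le_trans (cauchy_schwarz hH _ _) _.
by rewrite mulrAC ler_wpM2r// integrated_le.
Qed.

Variable Q : {linear H -> H}.
Hypotheses (hQ : continuous Q) (hQsa : selfadjoint ip Q).

(** With z = A* x, the intertwining relation gives S(t) Q x - Q x = V_t Q z. Indeed the
    product of the left side with k is <x, S(t) Q k - Q k> = <z, V_t Q k>, and Q can be
    moved through the semigroup again, under the integral. Divide by t. *)
Lemma intertwine_gen : (forall t, 0 <= t -> forall x, S t (Q x) = Q (Sa t x)) ->
  forall x, adj_dom ip (gen_dom S) (gen S) x ->
    gen_dom S (Q x) /\ gen S (Q x) = Q (adj ip (gen_dom S) (gen S) x).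
Proof.
move=> SQ x /adj_genP; set z := adj _ _ _ x => xz.
have E t : 0 <= t -> S t (Q x) - Q x = V t (Q z).
  move=> t0; apply: (ip_ext hH) => k.
  rewrite SQ// -linearB hQsa ipC -ipC ipBl SadjPr// -ipBr ipC (adj_gen_integrated _ xz)//.
  rewrite !integratedE//; apply: eq_Rintegral => s; rewrite inE/= in_itv/= => /andP[s0 _].
  by rewrite SQ// hQsa SadjPr// ipC.
have c : t^-1 *: (S t (Q x) - Q x) @[t --> 0^'+] --> Q z.
  apply: cvg_trans (@integrated_average_cvg _ _ _ hH _ hS (Q z)); apply: near_eq_cvg; near=> t.
  by have t0 : 0 <= t by []; rewrite E.
by split; [apply/cvg_ex; exists (Q z)|exact: cvg_lim c].
Unshelve. all: by end_near.
Qed.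

(** For x and y in the domain of A*, the function
    phi s = <Q S*(s) x, S*(t - s) y> joins <S(t) Q x, y> at s = 0 to <Q S*(t) x, y> at
    s = t. The terms of first order in phi (s + u) - phi s cancel since A Q = Q A*, and
    the others are O(u^2) uniformly in s; so phi is constant. The domain of A* is
    weakly dense, hence the two operators agree. *)
Lemma gen_intertwine : (forall x, adj_dom ip (gen_dom S) (gen S) x ->
    gen_dom S (Q x) /\ gen S (Q x) = Q (adj ip (gen_dom S) (gen S) x)) ->
  forall t, 0 <= t -> forall x, S t (Q x) = Q (Sa t x).
Proof.
move=> AQ' t t0 x.
have AQ a c : adj_gen a c -> gen_dom S (Q a) /\ gen S (Q a) = Q c.
  move=> ac; have da : adj_dom ip (gen_dom S) (gen S) a by exists c.
  have [d ->] := AQ' a da; split=> //; congr (Q _).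
  exact: adj_gen_unique (adj_genP da) ac.
have [M M0 MP] := semigroup_locally_bounded hS t.
have [q q0 qP] := continuous_op_bounded hQ.
suff key x0 x0' y y' : adj_gen x0 x0' -> adj_gen y y' -> ip (S t (Q x0)) y = ip (Q (Sa t x0)) y.
  have Sy y y' : adj_gen y y' -> S t (Q y) = Q (Sa t y).
    move=> yy; apply: adj_gen_dense => x0 x0' xx.
    by rewrite -SadjPr// -hQsa -(key _ _ _ _ xx yy) SadjP// hQsa.
  apply: adj_gen_dense => y y' yy.
  by rewrite -SadjPr// -hQsa -(Sy _ _ yy) SadjP// hQsa.
move=> xx yy.
pose phi s := ip (Q (Sa s x0)) (Sa (t - s) y).
suff : phi t = phi 0 by rewrite /phi subrr subr0 !Sadj0 SadjP.
pose C := 2 * M * q * (M * `|x0'|) * (M * `|y'|).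
apply: (@quadratic_increments_constant _ _ _ C) => // s u s0 u0 sut.
have st : s <= t by lra.
have r0 : 0 <= t - (s + u) by lra.
have rt : t - (s + u) <= t by lra.
pose a := Sa s x0; pose c := Sa s x0'.
pose b := Sa (t - (s + u)) y; pose d := Sa (t - (s + u)) y'.
have ac : adj_gen a c by exact: adj_gen_Sadj.
have bd : adj_gen b d by exact: adj_gen_Sadj.
have nc : `|c| <= M * `|x0'| by apply: Sadj_le => // w; apply: MP; rewrite s0.
have nd : `|d| <= M * `|y'| by apply: Sadj_le => // w; apply: MP; rewrite r0.
have MPu w : 0 <= w <= u -> forall x, `|S w x| <= M * `|x|.
  move=> /andP[w0 wu] v; apply: MP; lra.
(* The terms - u <Q b, c> and - u <Q c, b> on the right cancel. *)
have E : phi (s + u) - phi s = ip (V u (Q b) - u *: Q b) c - ip (V u (Q c) - u *: Q c) b.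
  have -> : phi s = ip (S u (Q a)) b.
    by rewrite /phi SadjP// /b -SadjD//; congr (ip _ (Sa _ _)); ring.
  have -> : phi (s + u) = ip (Q (Sa u a)) b by rewrite /phi /a -SadjD// [u + s]addrC.
  have [da ga] := AQ _ _ ac.
  have -> : ip (Q (Sa u a)) b = ip (Q a) b + ip (V u (Q b)) c.
    by rewrite !hQsa SadjPr// -(adj_gen_integrated _ ac)// ipBl !(ipC ip a) addrC subrK.
  have -> : ip (S u (Q a)) b = ip (Q a) b + ip (V u (Q c)) b.
    by rewrite -ga integrated_gen// ipBl addrC subrK.
  rewrite !ipBl !ipZl (hQsa b) (ipC ip b); ring.
rewrite E (le_trans (ler_normB _ _))//.
have h1 : `|ip (V u (Q b) - u *: Q b) c| <= u * (u * M * q * (M * `|y'|) * (M * `|x0'|)).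
  have nQ v : `|Q v| <= q * `|v| by [].
  apply: le_trans (cauchy_schwarz hH _ _) _; rewrite !mulrA -[leRHS]mulrA.
  apply: ler_pM => //; rewrite -!mulrA; apply: integrated_near => // [|w /andP[w0 wu]].
    by rewrite !mulr_ge0 ?(ltW M0) ?(ltW q0).
  have [db gb] := AQ _ _ bd.
  rewrite -(integrated_gen hH hS)// gb; apply: le_trans (integrated_le hH hS _ w0 (ltW M0) _) _.
    by move=> v /andP[v0 vw]; apply: MP; lra.
  rewrite -!mulrA; apply: ler_pM => //; first by rewrite mulr_ge0// ltW.
  rewrite ler_wpM2l ?(ltW M0)//; apply: le_trans (nQ _) _.
  by rewrite ler_wpM2l ?(ltW q0).
have h2 : `|ip (V u (Q c) - u *: Q c) b| <= u * (u * M * q * (M * `|x0'|) * (M * `|y'|)).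
  apply: integrated_near_weak => // w /andP[w0 wu].
  rewrite (adj_gen_integrated _ bd)//; apply: le_trans (cauchy_schwarz hH _ _) _.
  apply: ler_pM => //; apply: le_trans (integrated_le hH hS _ w0 (ltW M0) _) _.
    by move=> v /andP[v0 vw]; apply: MP; lra.
  rewrite -!mulrA; apply: ler_pM => //; first by rewrite mulr_ge0// ltW.
  rewrite ler_wpM2l ?(ltW M0)//; apply: le_trans (qP _) _.
  by rewrite ler_wpM2l ?(ltW q0).
rewrite /C; move: h1 h2; lra.
Qed.
End adjoint.

(** * Bounded pointwise closure of the trigonometric functions *)

Section stone.
Context {R : realType}.

Lemma bernoulli_pow (x : R) n : 0 <= x -> 1 + n%:R * x <= (1 + x) ^+ n.
Proof.
move=> x0; elim: n => [|n IH]; first by rewrite mul0r addr0 expr0.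
have xx : 0 <= n%:R * x ^+ 2 by rewrite mulr_ge0// sqr_ge0.
rewrite exprS -[n.+1]addn1 natrD.
apply: le_trans (_ : (1 + x) * (1 + n%:R * x) <= _).
  by have := xx; nra.
by rewrite ler_wpM2l// addr_ge0.
Qed.

Lemma bernoulli_pow_sub (x : R) n : 0 <= x <= 1 -> 1 - n%:R * x <= (1 - x) ^+ n.
Proof.
move=> /andP[x0 x1]; elim: n => [|n IH]; first by rewrite mul0r subr0 expr0.
have xx : 0 <= n%:R * x ^+ 2 by rewrite mulr_ge0// sqr_ge0.
rewrite exprS -[n.+1]addn1 natrD.
apply: le_trans (_ : (1 - x) * (1 - n%:R * x) <= _).
  by have := xx; nra.
by rewrite ler_wpM2l// subr_ge0.
Qed.

(** By Bernoulli's inequality (1 - u^n)^(2^n) tends to 1 for u < 1/2 and to 0 for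
    u > 1/2; the factor 1 - 2u takes care of u = 1/2. These polynomials are those of
    Stone's proof of the Weierstrass theorem. *)
Lemma stone_kernel_cvg (u : R) : 0 <= u <= 1 ->
  (1 - 2 * u) * (1 - u ^+ n) ^+ (2 ^ n) @[n --> \oo] --> Num.max (1 - 2 * u) 0.
Proof.
move=> /andP[u0 u1].
have un n : 0 <= u ^+ n <= 1 by rewrite exprn_ge0// exprn_ile1.
have k0 n : 0 <= (1 - u ^+ n) ^+ (2 ^ n).
  by rewrite exprn_ge0// subr_ge0; have /andP[] := un n.
have k1 n : (1 - u ^+ n) ^+ (2 ^ n) <= 1.
  have /andP[a b] := un n.
  by rewrite exprn_ile1// ?subr_ge0// lerBlDr lerDl.
have [u2|u2|->] := ltgtP u 2^-1; last 1 first.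
- rewrite mulfV// subrr maxxx.
  by apply: cvg_near_cst; apply: nearW => n; rewrite mul0r.
- rewrite max_l; last by lra.
  rewrite -[X in _ --> X]mulr1; apply: cvgMr.
  apply: (@squeeze_cvgr _ _ _ _ (fun n => 1 - (2 * u) ^+ n) (cst 1)).
  + apply: nearW => n; rewrite k1 andbT.
    have := bernoulli_pow_sub (2 ^ n) (un n).
    by rewrite natrX -exprMn.
  + rewrite -[X in _ --> X]subr0; apply: cvgB; first exact: cvg_cst.
    by apply: cvg_expr; rewrite ger0_norm ?mulr_ge0//; lra.
  + exact: cvg_cst.
- rewrite max_r; last by lra.
  rewrite -[X in _ --> X](mulr0 (1 - 2 * u)); apply: cvgMr.
  have up : 0 < u by lra.
  apply: (@squeeze_cvgr _ _ _ _ (cst 0) (fun n => ((2 * u)^-1) ^+ n)).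
  + apply: nearW => n; rewrite k0/=.
    rewrite exprVn -[leRHS]mul1r ler_pdivlMr ?exprn_gt0 ?mulr_gt0//.
    have h := bernoulli_pow (2 ^ n) (andP (un n)).1.
    apply: le_trans (_ : (1 - u ^+ n) ^+ (2 ^ n) * (1 + u ^+ n) ^+ (2 ^ n) <= _).
      rewrite ler_wpM2l//; apply: le_trans h.
      by rewrite natrX -exprMn lerDr.
    rewrite -exprMn -subr_sqr expr1n exprn_ile1//.
      by rewrite subr_ge0 exprn_ile1//; have /andP[] := un n.
    by rewrite lerBlDr lerDl sqr_ge0.
  + exact: cvg_cst.
  + apply: cvg_expr; rewrite ger0_norm ?invr_ge0 ?mulr_ge0//.
    by rewrite invf_lt1 ?mulr_gt0//; lra.
Qed.

Lemma one_minus_pow_cvg (u : R) : 0 <= u <= 1 ->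
  1 - (1 - u) ^+ n @[n --> \oo] --> ((0 < u)%R%:R : R).
Proof.
move=> /andP[u0 u1]; have [<-|un0] := eqVneq 0 u.
  by apply: cvg_near_cst; apply: nearW => n; rewrite subr0 expr1n subrr ltxx.
have u_gt0 : 0 < u by rewrite lt_neqAle un0.
rewrite u_gt0 -[X in _ --> X]subr0; apply: cvgB; first exact: cvg_cst.
by apply: cvg_expr; rewrite ger0_norm ?subr_ge0// ltrBlDr ltrDl.
Qed.

End stone.

Section trig_closed.
Context {R : realType} (H : completeNormedModType R) (ip : {dot H for idfun}).
Hypothesis hH : is_hilbert ip.

(** The closure of the functions cos(<., h> + a) under linear combinations and bounded
    pointwise limits. Thanks to the phase a, a product of two of these functions is a
    linear combination of two others. *)
Inductive trig_closed : (H -> R) -> Prop :=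
| trig_cos h a : trig_closed (fun x => cos (ip x h + a))
| trig_lin a f g : trig_closed f -> trig_closed g -> trig_closed (fun x => a * f x + g x)
| trig_lim (f_ : nat -> H -> R) (f : H -> R) (M : R) : (forall n, trig_closed (f_ n)) ->
    (forall n x, `|f_ n x| <= M) -> (forall x, f_ n x @[n --> \oo] --> f x) -> trig_closed f.

Lemma trig_closed_bounded f : trig_closed f -> exists M, forall x, `|f x| <= M.
Proof.
elim=> [h a|a {}f g _ [M fM] _ [N gN]|f_ {}f M _ _ fM fl].
- by exists 1 => x; exact: cos_max.
- exists (`|a| * M + N) => x; rewrite (le_trans (ler_normD _ _))// lerD//.
  by rewrite normrM ler_wpM2l.
- exists M => x; have c : `|f_ n x| @[n --> \oo] --> `|f x| by apply: cvg_norm; exact: fl.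
  rewrite -(cvg_lim _ c)//; apply: limr_le; first exact: cvgP c.
  exact: nearW.
Qed.

Lemma trig_closed_cst c : trig_closed (cst c).
Proof.
have t1 : trig_closed (cst 1).
  by have := trig_cos 0 0; congr trig_closed; apply/funext => x; rewrite ip0r addr0 cos0.
have t0 : trig_closed (cst 0).
  by have := trig_lin (-1) t1 t1; congr trig_closed; apply/funext => x /=; rewrite mulN1r addNr.
by have := trig_lin c t1 t0; congr trig_closed; apply/funext => x /=; rewrite mulr1 addr0.
Qed.

Lemma trig_closed_scale c f : trig_closed f -> trig_closed (fun x => c * f x).
Proof.
move=> tf; have := trig_lin c tf (trig_closed_cst 0).
by congr trig_closed; apply/funext => x /=; rewrite addr0.
Qed.

Lemma trig_closed_sub f g : trig_closed f -> trig_closed g -> trig_closed (fun x => f x - g x).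
Proof.
move=> tf tg; have := trig_lin (-1) tg tf.
by congr trig_closed; apply/funext => x /=; rewrite mulN1r addrC.
Qed.

(** Two inductions, the inner one with the first factor equal to a cosine: for a fixed
    factor, the functions whose product with it is in the closure form a class with the
    same stability properties. *)
Lemma trig_closed_mul f g : trig_closed f -> trig_closed g -> trig_closed (fun x => f x * g x).
Proof.
move=> tf; move: g; elim: tf => [h a|a {}f f' _ IH _ IH'|f_ {}f M _ IH fM fl] g tg.
- elim: tg => [k b|b {}g g' _ IH _ IH'|g_ {}g M _ IH gM gl].
  + have := trig_closed_scale 2^-1 (trig_lin 1 (trig_cos (h + k) (a + b)) (trig_cos (h - k) (a - b))).
    congr trig_closed; apply/funext => x; rewrite ipDr ipBr mul1r.
    have -> : ip x h + ip x k + (a + b) = (ip x h + a) + (ip x k + b) by ring.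
    have -> : ip x h - ip x k + (a - b) = (ip x h + a) - (ip x k + b) by ring.
    by rewrite cosD cosB; field.
  + by have := trig_lin b IH IH'; congr trig_closed; apply/funext => x; ring.
  + apply: (trig_lim (M := M) IH) => [n x|x].
      by rewrite normrM -[leRHS]mul1r ler_pM// cos_max.
    by apply: cvgMr; exact: gl.
- by have := trig_lin a (IH _ tg) (IH' _ tg); congr trig_closed; apply/funext => x; ring.
- have [N gN] := trig_closed_bounded tg.
  apply: (trig_lim (M := M * N) (fun n => IH n g tg)) => [n x|x].
    by rewrite normrM ler_pM.
  by apply: cvgMl; exact: fl.
Qed.

Lemma trig_closed_pow f n : trig_closed f -> trig_closed (fun x => f x ^+ n).
Proof.
move=> tf; elim: n => [|n IH].
  by have := trig_closed_cst 1; congr trig_closed; apply/funext => x; rewrite expr0.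
by have := trig_closed_mul tf IH; congr trig_closed; apply/funext => x; rewrite exprS.
Qed.

(** The positive part is a pointwise limit of polynomials by [stone_kernel_cvg], at
    u = (1 - f) / 2. *)
Lemma trig_closed_pos f : trig_closed f -> (forall x, `|f x| <= 1) ->
  trig_closed (fun x => Num.max (f x) 0).
Proof.
move=> tf f1; pose u x := 2^-1 * (1 - f x).
have u01 x : 0 <= u x <= 1 by have /ler_normlP[] := f1 x; rewrite /u => *; lra.
have tu : trig_closed u by apply/trig_closed_scale/trig_closed_sub => //; exact: trig_closed_cst.
have fE x : f x = 1 - 2 * u x by rewrite /u; lra.
apply: (@trig_lim (fun n x => f x * (1 - u x ^+ n) ^+ (2 ^ n)) _ 1).
- move=> n; apply: trig_closed_mul => //; apply: trig_closed_pow.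
  by apply: trig_closed_sub; [exact: trig_closed_cst|exact: trig_closed_pow].
- move=> n x; have /andP[a b] := u01 x.
  rewrite normrM -[leRHS]mul1r ler_pM// ger0_norm.
    by rewrite exprn_ile1// ?subr_ge0 ?exprn_ile1// lerBlDr lerDl exprn_ge0.
  by rewrite exprn_ge0// subr_ge0 exprn_ile1.
- by move=> x; rewrite fE; exact: stone_kernel_cvg.
Qed.

Lemma trig_closed_gt0 f : trig_closed f -> (forall x, `|f x| <= 1) ->
  trig_closed (fun x => ((0 < f x)%R)%:R).
Proof.
move=> tf f1; have tp := trig_closed_pos tf f1.
have p01 x : 0 <= Num.max (f x) 0 <= 1.
  by rewrite le_max lexx orbT/= ge_max ler01 andbT; have /ler_normlP[] := f1 x.
apply: (@trig_lim (fun n x => 1 - (1 - Num.max (f x) 0) ^+ n) _ 1).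
- move=> n; apply: trig_closed_sub; first exact: trig_closed_cst.
  by apply: trig_closed_pow; apply: trig_closed_sub => //; exact: trig_closed_cst.
- move=> n x; have /andP[a b] := p01 x; rewrite ger0_norm.
    by rewrite lerBlDr lerDl exprn_ge0// subr_ge0.
  by rewrite subr_ge0 exprn_ile1// ?subr_ge0// lerBlDr lerDl.
- move=> x; have -> : (0 < f x) = (0 < Num.max (f x) 0) by rewrite lt_max ltxx orbF.
  exact: one_minus_pow_cvg.
Qed.

(** For n large, sin((<x, h> - c) / n) has the sign of <x, h> - c; and a sine is a
    cosine with a phase. *)
Lemma trig_closed_halfspace h c : trig_closed (fun x => ((c < ip x h)%R)%:R).
Proof.
pose f_ n x := cos (ip x (harmonic n *: h) + (- (harmonic n * c) - pi / 2)).
have fE n x : f_ n x = sin (harmonic n * (ip x h - c)).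
  by rewrite /f_ ipZr addrA -mulrBr cosBpihalf.
apply: (@trig_lim (fun n x => ((0 < f_ n x)%R)%:R) _ 1).
- move=> n; apply: trig_closed_gt0; first exact: trig_cos.
  by move=> x; exact: cos_max.
- by move=> n x; case: (_ < _); rewrite ?normr1 ?normr0.
- move=> x; apply: cvg_near_cst; set y := ip x h - c.
  have e0 : 0 < pi / (`|y| + 1) :> R by rewrite divr_gt0 ?pi_gt0// ltr_wpDl.
  have /cvgr0_norm_lt/(_ _ e0) := @cvg_harmonic R; apply: filterS => n /ltr_normlP[_].
  have y1 : 0 < `|y| + 1 by rewrite ltr_wpDl.
  rewrite (ltr_pdivlMr _ _ y1) => hn; rewrite fE -/y -[c < _]subr_gt0 -/y.
  have h0 : 0 < harmonic n :> R by exact: harmonic_gt0.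
  have hy : harmonic n * `|y| < pi.
    by apply: le_lt_trans hn; rewrite ler_wpM2l ?(ltW h0)// lerDl.
  have [y0|y0|y0] := ltgtP 0 y; last by rewrite -y0 mulr0 sin0 ltxx.
    rewrite gtr0_norm// in hy.
    by rewrite (@sin_gt0_pi _ (harmonic n * y)) ?hy ?mulr_gt0.
  rewrite ltr0_norm// in hy.
  rewrite [0 < sin _]lt_neqAle leNgt -oppr_gt0 -sinN -mulrN.
  by rewrite (@sin_gt0_pi _ (harmonic n * - y)) ?hy ?mulr_gt0 ?oppr_gt0// andbF.
Qed.

Definition trig_set (A : set H) := trig_closed (\1_A).

Lemma trig_set_setC A : trig_set A -> trig_set (~` A).
Proof.
move=> tA; have := trig_closed_sub (trig_closed_cst 1) tA.
by congr trig_closed; apply/funext => x /=; rewrite !indicE in_setC; case: (_ \in _); rewrite ?subrr ?subr0.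
Qed.

Lemma trig_set_setI A B : trig_set A -> trig_set B -> trig_set (A `&` B).
Proof.
move=> tA tB; have := trig_closed_mul tA tB; rewrite /trig_set.
by congr trig_closed; apply/funext => x; rewrite !indicE in_setI; do 2 case: (_ \in _); rewrite ?mulr0 ?mul0r ?mulr1.
Qed.

Lemma trig_set0 : trig_set set0.
Proof. by rewrite /trig_set indic0; exact: trig_closed_cst. Qed.

Lemma trig_set_setU A B : trig_set A -> trig_set B -> trig_set (A `|` B).
Proof.
move=> tA tB; rewrite -[_ `|` _]setCK setCU.
by apply: trig_set_setC; apply: trig_set_setI; exact: trig_set_setC.
Qed.

Lemma trig_set_bigcup (F : nat -> set H) : (forall n, trig_set (F n)) -> trig_set (\bigcup_n F n).
Proof.
move=> tF; apply: (@trig_lim (fun n => \1_(\big[setU/set0]_(i < n) F i)) _ 1).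
- move=> n; rewrite -/(trig_set _); elim: n => [|n IH]; first by rewrite big_ord0; exact: trig_set0.
  by rewrite big_ord_recr; exact: trig_set_setU.
- by move=> n x; rewrite indicE; case: (_ \in _); rewrite ?normr1 ?normr0.
- move=> x; apply: cvg_near_cst.
  have [[k _ Fk]|nF] := pselect ((\bigcup_n F n) x).
    exists k.+1 => // n /= kn; rewrite !indicE mem_set; last by rewrite -bigcup_mkord; exists k.
    by rewrite mem_set//; exists k.
  apply: nearW => n; rewrite !indicE memNset ?memNset//.
  by rewrite -bigcup_mkord => -[k _ Fk]; apply: nF; exists k.
Qed.

Lemma trig_set_sigma_algebra : sigma_algebra setT trig_set.
Proof.
split; [exact: trig_set0| |exact: trig_set_bigcup].
by move=> A tA; rewrite setTD; exact: trig_set_setC.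
Qed.

Hypothesis hsep : separable_space H.

Lemma dense_seq : exists d : nat -> H, forall x (e : R), 0 < e -> exists n, `|x - d n| < e.
Proof.
have [D cD dD] := hsep.
have D0 : D !=set0.
  have [x [_ Dx]] := dD setT (ex_intro _ point I) openT.
  by exists x.
have /pfcard_geP[D00|/unsquash d] := cD; first by move: D0; rewrite D00 => -[].
exists d => x e e0.
have bxe : ball x e !=set0 by exists x; exact: ballxx.
have obxe : open (ball x e) by exact: ball_open.
have [y [xy Dy]] := dD (ball x e) bxe obxe.
have [n _ dn] := @surj _ _ _ _ d y Dy.
by exists n; rewrite dn; move: xy; rewrite -ball_normE.
Qed.

(** |y| <= r if and only if <y, d> <= r |d| for every d of a dense sequence: a closed
    ball is a countable intersection of half-spaces. *)
Lemma trig_set_closed_ball a r : 0 <= r -> trig_set [set x | `|x - a| <= r].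
Proof.
move=> r0; have [d dP] := dense_seq.
have -> : [set x | `|x - a| <= r] = ~` \bigcup_n [set x | r * `|d n| + ip a (d n) < ip x (d n)].
  apply/seteqP; split => x /=.
    move=> xr [n _ /=]; rewrite -ltrBrDr -ipBl ltNge => /negP; apply.
    rewrite (le_trans (ler_norm _))// (le_trans (cauchy_schwarz hH _ _))//.
    by rewrite ler_wpM2r.
  move=> nx; set y := x - a.
  have yd n : ip y (d n) <= r * `|d n|.
    rewrite leNgt; apply/negP => lt; apply: nx; exists n => //=.
    by rewrite -ltrBrDr -ipBl.
  have yy : `|y| ^+ 2 <= r * `|y|.
    apply/ler_addgt0Pr => e e0.
    (* Replace the second y in <y, y> by a point d n close to it. *)
    have c0 : 0 < `|y| + r + 1 by rewrite ltr_wpDl// addr_ge0.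
    have [n nP] := dP y (e / (`|y| + r + 1)) (divr_gt0 e0 c0).
    rewrite hH -{2}[y](subrK (d n)) ipDr.
    have h1 : ip y (y - d n) <= `|y| * `|y - d n|.
      exact: le_trans (ler_norm _) (cauchy_schwarz hH _ _).
    have h2 : `|d n| <= `|y| + `|y - d n|.
      by rewrite -{1}[d n](subKr y) (le_trans (ler_normB _ _)).
    have h3 := yd n.
    have h4 : (`|y| + r + 1) * `|y - d n| <= e by rewrite -ler_pdivlMl// mulrC ltW.
    have h5 : r * `|d n| <= r * (`|y| + `|y - d n|) by rewrite ler_wpM2l.
    have h6 := normr_ge0 (y - d n).
    lra.
  have [->|y0] := eqVneq `|y| 0; first by [].
  by move: yy; rewrite expr2 ler_pM2r// lt_neqAle eq_sym y0 normr_ge0.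
apply: trig_set_setC; apply: trig_set_bigcup => n.
have := trig_closed_halfspace (d n) (r * `|d n| + ip a (d n)).
rewrite /trig_set; congr trig_closed; apply/funext => x.
by rewrite indicE; congr (nat_of_bool _)%:R; apply/idP/idP; rewrite inE.
Qed.

(** By separability an open set is a countable union of closed balls. *)
Lemma trig_set_open U : open U -> trig_set U.
Proof.
move=> oU; have [d dP] := dense_seq.
pose F n k := if `[< [set x | `|x - d n| <= harmonic k] `<=` U >]
  then [set x | `|x - d n| <= harmonic k] else set0.
have -> : U = \bigcup_n \bigcup_k F n k.
  apply/seteqP; split => x; last first.
    by move=> [n _ [k _]]; rewrite /F; case: asboolP => // s /s.
  move=> Ux.
  have /nbhs_normP[e /= e0 eU] : nbhs x U by exact: open_nbhs_nbhs.
  have e2 : 0 < e / 2 by rewrite divr_gt0.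
  have [k _ /(_ k (leqnn k)) kP] : \forall n \near \oo, (harmonic n : R) < e / 2.
    by have /cvgr0_norm_lt/(_ _ e2) := @cvg_harmonic R; apply: filterS => n /ltr_normlP[].
  have [n nP] := dP x (harmonic k) (harmonic_gt0 _).
  exists n => //; exists k => //; rewrite /F; case: asboolP => [_ /=|]; first exact: ltW.
  case=> y /= yd; apply: eU => /=; rewrite -[x - y](subrKA (d n)).
  rewrite (le_lt_trans (ler_normD _ _))// (splitr e) ltrD//; first exact: lt_trans kP.
  by rewrite distrC (le_lt_trans yd).
apply: trig_set_bigcup => n; apply: trig_set_bigcup => k; rewrite /F.
by case: ifP => _; [apply/trig_set_closed_ball/ltW/harmonic_gt0|exact: trig_set0].
Qed.

Lemma trig_set_borel (A : set (borel H)) : measurable A -> trig_set A.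
Proof.
apply: smallest_sub; first exact: trig_set_sigma_algebra.
exact: trig_set_open.
Qed.

End trig_closed.

(** * Density of the trigonometric functions in the square integrable functions *)

Section L2.
Context d (T : measurableType d) {R : realType} (mu : probability T R).

Implicit Types f g : T -> R.

Definition L2 (f : T -> R) :=
  measurable_fun setT f /\ mu.-integrable setT (EFin \o (fun x => f x ^+ 2)).

Lemma Lfun2P (f : T -> R) : (f \in Lfun mu 2%:E) <-> L2 f.
Proof.
split=> [Lf|[mf fi]].
  split; last exact: Lfun2_integrable_sqr.
  by move: Lf; rewrite inE => /andP[]; rewrite inE.
rewrite inE; apply/andP; split; first by rewrite inE.
rewrite inE/= /finite_norm unlock /Lnorm poweR_lty//.
have /integrableP[_] := fi; congr (_ < _)%E; apply: eq_integral => x _ /=.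
by rewrite powR_mulrn// normrX.
Qed.

Lemma L2_mul f g : L2 f -> L2 g -> mu.-integrable setT (EFin \o (fun x => f x * g x)).
Proof. by move=> /Lfun2P Lf /Lfun2P Lg; apply/Lfun1_integrable; exact: Lfun2_mul_Lfun1. Qed.

Lemma L2_linear a f g : L2 f -> L2 g -> L2 (fun x => a * f x + g x).
Proof.
move=> Lf Lg; have [mf fi] := Lf; have [mg gi] := Lg; split.
  by apply: measurable_funD => //; apply: measurable_funM.
have := integrable_linear (a ^+ 2) measurableT fi (integrable_linear (2 * a) measurableT (L2_mul Lf Lg) gi).
by apply: eq_integrable => // x _ /=; congr EFin; ring.
Qed.

Lemma L2_sub f g : L2 f -> L2 g -> L2 (fun x => f x - g x).
Proof.
move=> Lf Lg; have := L2_linear (-1) Lg Lf.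
by congr L2; apply/funext => x; rewrite mulN1r addrC.
Qed.

Lemma L2_bounded f M : measurable_fun setT f -> (forall x, `|f x| <= M) -> L2 f.
Proof.
move=> mf fM; split=> //.
apply: (le_integrable measurableT (g := EFin \o cst (M ^+ 2))).
- by apply/measurable_EFinP; exact: measurable_funX.
- move=> x _; rewrite /= lee_fin !normrX.
  by rewrite ler_sqr ?nnegrE// (le_trans (fM x))// ler_norm.
- exact: finite_measure_integrable_cst.
Qed.

(** The weighted inequality |f g| <= k f^2 / 2 + g^2 / (2 k) with k small gives the
    convergence without square roots. *)
Lemma L2_pairing_cvg0 f (g_ : nat -> T -> R) : L2 f -> (forall n, L2 (g_ n)) ->
  \int[mu]_x (g_ n x ^+ 2) @[n --> \oo] --> 0 ->
  \int[mu]_x (f x * g_ n x) @[n --> \oo] --> 0.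
Proof.
move=> Lf Lg gl; apply/cvgrPdist_le => e e0.
pose F := \int[mu]_x (f x ^+ 2).
have F0 : 0 <= F by apply: Rintegral_ge0 => x _; exact: sqr_ge0.
pose k := e / (F + 1).
have k0 : 0 < k by rewrite divr_gt0// ltr_wpDl.
have /cvgr0_norm_lt/(_ (e * k) (mulr_gt0 e0 k0)) := gl; apply: filterS => n gn.
rewrite sub0r normrN.
apply: le_trans (le_normr_Rintegral measurableT (L2_mul Lf (Lg n))) _.
apply: le_trans (_ : \int[mu]_x (k / 2 * f x ^+ 2 + k^-1 / 2 * g_ n x ^+ 2) <= _).
  apply: le_Rintegral => //.
  - by have := integrable_norm (L2_mul Lf (Lg n)); apply: eq_integrable.
  - have i2 := integrable_linear (k^-1 / 2) measurableT (Lg n).2 (finite_measure_integrable_cst mu 0 measurableT).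
    have := integrable_linear (k / 2) measurableT Lf.2 i2.
    by apply: eq_integrable => // x _ /=; rewrite addr0.
  - move=> x _; rewrite normrM.
    have h : 0 <= k^-1 / 2 * (k * `|f x| - `|g_ n x|) ^+ 2.
      by rewrite mulr_ge0 ?sqr_ge0// divr_ge0// invr_ge0 ltW.
    rewrite -(real_normK (num_real (f x))) -(real_normK (num_real (g_ n x))).
    have E : k^-1 / 2 * (k * `|f x| - `|g_ n x|) ^+ 2 =
      k / 2 * `|f x| ^+ 2 + k^-1 / 2 * `|g_ n x| ^+ 2 - `|f x| * `|g_ n x|.
      by field; rewrite gt_eqF.
    by rewrite E subr_ge0 in h.
rewrite Rintegral_linear//; [|exact: Lf.2|]; last first.
  have i2 := integrable_linear (k^-1 / 2) measurableT (Lg n).2 (finite_measure_integrable_cst mu 0 measurableT).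
  by move: i2; apply: eq_integrable => // x _ /=; rewrite addr0.
rewrite RintegralZl//; last exact: (Lg n).2.
have h1 : k * F <= e by rewrite /k mulrAC ler_pdivrMr ?ltr_wpDl// ler_wpM2l ?(ltW e0)// lerDl.
have h2 : k^-1 * \int[mu]_x (g_ n x ^+ 2) <= e.
  rewrite ler_pdivrMl// mulrC (le_trans (ler_norm _))//; exact/ltW.
rewrite -/F; lra.
Qed.

Lemma L2_dominated_cvg (f_ : nat -> T -> R) f g : (forall n, measurable_fun setT (f_ n)) ->
  (forall x, f_ n x @[n --> \oo] --> f x) -> L2 g ->
  (forall n x, `|f_ n x - f x| <= g x) ->
  \int[mu]_x ((f_ n x - f x) ^+ 2) @[n --> \oo] --> 0.
Proof.
move=> mf ff Lg fg.
have mf' : measurable_fun setT f by exact: measurable_realfun.measurable_fun_cvg (fun x _ => ff x).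
have [||||_] := @Rintegral_dominated_cvg _ _ _ mu setT (fun n x => (f_ n x - f x) ^+ 2) (cst 0) (fun x => g x ^+ 2) measurableT.
- by move=> n; apply: measurable_funX; exact: measurable_funB.
- move=> x _; have c : f_ n x - f x @[n --> \oo] --> 0.
    by rewrite -(subrr (f x)); apply: cvgB => //; exact: cvg_cst.
  have : (f_ n x - f x) * (f_ n x - f x) @[n --> \oo] --> (0 * 0 : R) by apply: cvgM.
  by rewrite mulr0; under eq_fun do rewrite -expr2.
- exact: Lg.2.
- by move=> n x _; rewrite ger0_norm ?sqr_ge0// -real_normK ?num_real// ler_sqr ?nnegrE// (le_trans _ (fg n x)).
by rewrite Rintegral_cst// mul0r.
Qed.

Lemma Lnorm2_le_sqr f g :
  L2 f -> L2 g -> ('N[mu]_2%:E[EFin \o f] <= 'N[mu]_2%:E[EFin \o g])%E ->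
  \int[mu]_x (f x ^+ 2) <= \int[mu]_x (g x ^+ 2).
Proof.
move=> Lf Lg fg.
have E (h : T -> R) : ('N[mu]_2%:E[EFin \o h] `^ 2 = \int[mu]_x (h x ^+ 2)%:E)%E.
  rewrite poweR_Lnorm ?pnatr_eq0//; apply: eq_integral => x _ /=.
  by rewrite powR_mulrn// real_normK ?num_real.
rewrite -lee_fin /Rintegral !fineK; [|exact: integrable_fin_num Lg.2|exact: integrable_fin_num Lf.2].
rewrite -!E; apply: gt0_ler_poweR => //; by rewrite in_itv/= leey Lnorm_ge0.
Qed.

End L2.

Section density.
Import HBNNSimple.
Context {R : realType} (H : completeNormedModType R) (ip : {dot H for idfun}).
Hypotheses (hH : is_hilbert ip) (hsep : separable_space H).
Variable mu : probability (borel H) R.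

Lemma borel_continuous_measurable (f : H -> R) : continuous f ->
  measurable_fun [set: borel H] (f : borel H -> R).
Proof.
move=> cf; apply: (measurability _ (RGenOInfty.measurableE R)) => //.
move=> _ [_ [a ->] <-]; rewrite setTI.
apply: sub_sigma_algebra; apply: open_comp => // x _; exact: cf.
Qed.

Lemma ip_measurable h : measurable_fun [set: borel H] ((fun x => ip x h) : borel H -> R).
Proof. by apply: borel_continuous_measurable => x; exact: ip_cvgl. Qed.

Lemma cos_ip_measurable h a : measurable_fun [set: borel H] ((fun x => cos (ip x h + a)) : borel H -> R).
Proof.
have := @measurable_cos_affine R a 1.
under eq_fun do rewrite mul1r.
by move=> mc; exact: (measurableT_comp mc (ip_measurable h)).
Qed.

Lemma trig_closed_measurable f : trig_closed ip f -> measurable_fun [set: borel H] (f : borel H -> R).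
Proof.
elim=> [h a|a {}f g _ mf _ mg|f_ {}f M _ mf fM fl].
- exact: cos_ip_measurable.
- by apply: measurable_funD => //; exact: measurable_funM.
- exact: (measurable_realfun.measurable_fun_cvg mf (fun x _ => fl x)).
Qed.

Lemma trig_closed_L2 f : trig_closed ip f -> L2 mu f.
Proof.
move=> tf; have [M fM] := trig_closed_bounded tf.
exact: L2_bounded (trig_closed_measurable tf) fM.
Qed.

Variable Phi : (borel H -> R) -> Prop.
Hypothesis Phi_cos : forall h a, Phi (fun x => cos (ip x h + a)).
Hypothesis Phi_lin : forall a f g, L2 mu f -> L2 mu g -> Phi f -> Phi g ->
  Phi (fun x => a * f x + g x).
Hypothesis Phi_lim : forall (f_ : nat -> borel H -> R) f, (forall n, L2 mu (f_ n)) -> L2 mu f ->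
  (forall n, Phi (f_ n)) -> \int[mu]_x ((f_ n x - f x) ^+ 2) @[n --> \oo] --> 0 -> Phi f.

Lemma L2_class_trig_closed f : trig_closed ip f -> Phi f.
Proof.
elim=> [h a|a {}f g tf Pf tg Pg|f_ {}f M tf Pf fM fl].
- exact: Phi_cos.
- by apply: Phi_lin => //; exact: trig_closed_L2.
- have tf' : trig_closed ip f by exact: trig_lim tf fM fl.
  apply: (Phi_lim (f_ := f_)) => // [n||]; [exact: trig_closed_L2..|].
  have fM' x : `|f x| <= M.
    have c : `|f_ n x| @[n --> \oo] --> `|f x| by apply: cvg_norm; exact: fl.
    rewrite -(cvg_lim _ c)//; apply: limr_le; first exact: cvgP c.
    exact: nearW.
  apply: (@L2_dominated_cvg _ _ _ mu f_ f (cst (M + M))) => // [n||n x].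
  + exact: trig_closed_measurable.
  + by apply: (@L2_bounded _ _ _ mu _ `|M + M|).
  + by rewrite (le_trans (ler_normB _ _))// lerD.
Qed.

Lemma L2_indic (A : set (borel H)) : measurable A -> L2 mu (\1_A).
Proof.
move=> mA; apply: (@L2_bounded _ _ _ mu _ 1) => // x.
by rewrite indicE; case: (_ \in _); rewrite ?normr1 ?normr0.
Qed.

Lemma L2_class_nnsfun (f : {nnsfun (borel H) >-> R}) : Phi f /\ L2 mu f.
Proof.
have -> : (f : borel H -> R) = (fun x => \sum_(y <- finmap.enum_fset (fset_set (range f))) (y * \1_(f @^-1` [set y]) x)).
  by apply/funext => x; rewrite [LHS]fimfunE fsbig_finite.
have t0 : trig_closed ip (cst 0) by exact: trig_closed_cst.
elim: (finmap.enum_fset _) => [|y s [IH1 IH2]].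
  under eq_fun do rewrite big_nil.
  by split; [exact: L2_class_trig_closed|exact: trig_closed_L2].
under eq_fun do rewrite big_cons.
have my : measurable (f @^-1` [set y]) by exact: measurable_sfunP.
have Ly := L2_indic my.
split; last exact: L2_linear.
apply: Phi_lin => //; apply: L2_class_trig_closed; exact: trig_set_borel.
Qed.

Lemma L2_class_ge0 f : (forall x, 0 <= f x) -> L2 mu f -> Phi f.
Proof.
move=> f0 Lf; have mf := (measurable_EFinP _ _).2 Lf.1.
pose f_ n := nnsfun_approx measurableT mf n.
have f0' x : setT x -> (0 <= (EFin \o f) x)%E by move=> _; rewrite lee_fin.
have fl x : f_ n x @[n --> \oo] --> f x.
  have := cvg_nnsfun_approx measurableT mf f0' (I : setT x).
  by move=> /fine_cvg.
have ff n x : f_ n x <= f x.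
  by rewrite -lee_fin /f_ nnsfun_approxE; exact: (@le_approx _ _ _ setT (EFin \o f) n x f0' I).
apply: (Phi_lim (f_ := fun n => f_ n)) => // [n|n|]; [exact: (L2_class_nnsfun (f_ n)).2|exact: (L2_class_nnsfun (f_ n)).1|].
apply: (@L2_dominated_cvg _ _ _ mu (fun n => f_ n) f f) => // n x.
by rewrite distrC ger0_norm ?subr_ge0// lerBlDr lerDl.
Qed.

(** The trigonometric functions are dense in L^2(mu), in the form of an induction
    principle for a property Phi that is stable under linear combinations and L^2 limits.
    The indicators of Borel sets are reached by bounded limits, then come simple
    functions, nonnegative functions, and differences. *)
Lemma L2_trig_dense f : L2 mu f -> Phi f.
Proof.
move=> Lf; have mf := Lf.1.
have max_L2 (g : borel H -> R) : L2 mu g -> L2 mu (fun x => Num.max (g x) 0).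
  move=> [mg gi]; split; first by apply: measurable_maxr.
  apply: (le_integrable measurableT _ _ gi).
    by apply/measurable_EFinP/measurable_funX; exact: measurable_maxr.
  move=> x _; rewrite lee_fin !normrX ler_sqr ?nnegrE//.
  by rewrite /Num.max; case: ifP => // _; rewrite normr0.
have Ln : L2 mu (fun x => - f x).
  have L0 : L2 mu (fun=> 0 : R).
    by apply: (@L2_bounded _ _ _ mu _ 0) => // x; rewrite normr0.
  by have := L2_sub L0 Lf; congr L2; apply/funext => x; rewrite sub0r.
have Lp := max_L2 _ Lf; have Lm := max_L2 _ Ln.
have -> : f = (fun x => (-1) * Num.max (- f x) 0 + Num.max (f x) 0).
  apply/funext => x; rewrite mulN1r.
  have [h|h] := leP 0 (f x); first by rewrite max_r ?oppr_le0// oppr0 add0r.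
  by rewrite max_l ?oppr_ge0 ?ltW// opprK addr0.
by apply: Phi_lin => //; apply: L2_class_ge0 => // x; rewrite le_max lexx orbT.
Qed.

End density.

(** * Wiener integrals *)

Section wiener.
Context {R : realType} (H : completeNormedModType R) (ip : {dot H for idfun}).
Hypothesis hH : is_hilbert ip.
Context d (Omega : measurableType d) (P : probability Omega R).
Variable W : R -> H -> {RV P >-> R}.
Hypothesis hW : cylindrical_wiener ip W.
Local Notation leb := (@lebesgue_measure R).

Lemma wiener_seq_law (l : seq (R * R * H)) : all (fun x => 0 <= x.1.2) l ->
  forall B : set R, measurable B ->
  P ((fun w => \sum_(x <- l) x.1.1 * W x.1.2 x.2 w) @^-1` B) =
  normal_law 0 (\sum_(x <- l) \sum_(y <- l)
     x.1.1 * y.1.1 * Num.min x.1.2 y.1.2 * ip x.2 y.2) B.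
Proof.
move=> l0 B mB; pose x0 : R * R * H := (0, 0, 0).
have [hW1 _] := hW.
have := hW1 (size l) (fun i => (nth x0 l i).1.1) (fun i => (nth x0 l i).1.2)
  (fun i => (nth x0 l i).2) _ B mB.
have -> : (fun w => \sum_(x <- l) x.1.1 * W x.1.2 x.2 w) =
    (fun w => \sum_(i < size l) (nth x0 l i).1.1 * W (nth x0 l i).1.2 (nth x0 l i).2 w).
  by apply/funext => w; rewrite (big_nth x0) big_mkord.
have -> : \sum_(x <- l) \sum_(y <- l) x.1.1 * y.1.1 * Num.min x.1.2 y.1.2 * ip x.2 y.2 =
  \sum_(i < size l) \sum_(j < size l) (nth x0 l i).1.1 * (nth x0 l j).1.1 *
     Num.min (nth x0 l i).1.2 (nth x0 l j).1.2 * ip (nth x0 l i).2 (nth x0 l j).2.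
  rewrite (big_nth x0) big_mkord; apply: eq_bigr => i _.
  by rewrite (big_nth x0) big_mkord.
by apply=> i; apply: (allP l0); exact: mem_nth.
Qed.

(** The length of the intersection of two intervals of endpoints i and j, as it comes
    out of the covariance min(s, t). *)
Definition overlap (i j : R * R) : R :=
  Num.min i.2 j.2 - Num.min i.2 j.1 - Num.min i.1 j.2 + Num.min i.1 j.1.

Definition step_variance (p : seq (R * R * H)) : R :=
  \sum_(i <- p) \sum_(j <- p) overlap i.1 j.1 * ip i.2 j.2.

Definition valid_step t (p : seq (R * R * H)) :=
  all (fun i => [&& 0 <= i.1.1, i.1.1 <= i.1.2 & i.1.2 <= t]) p.

Lemma step_int_law t p : valid_step t p ->
  forall B : set R, measurable B ->
  P (step_int W p @^-1` B) = normal_law 0 (step_variance p) B.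
Proof.
move=> vp B mB.
(* Each increment W(b)h - W(a)h is split into two terms with coefficients 1 and -1. *)
pose l := flatten [seq [:: (1 : R, i.1.2, i.2); (-1, i.1.1, i.2)] | i <- p].
have sumE (F : R * R * H -> R) : \sum_(x <- l) F x =
    \sum_(i <- p) (F (1, i.1.2, i.2) + F (-1, i.1.1, i.2)).
  rewrite /l big_flatten big_map; apply: eq_bigr => i _.
  by rewrite !big_cons big_nil /= addr0.
have l0 : all (fun x => 0 <= x.1.2) l.
  apply/allP => x /flatten_mapP[i /(allP vp)/and3P[a0 ab _]].
  by rewrite !inE => /orP[]/eqP -> //=; exact: le_trans ab.
have := wiener_seq_law l0 mB.
have -> : (fun w => \sum_(x <- l) x.1.1 * W x.1.2 x.2 w) = step_int W p.
  apply/funext => w; rewrite sumE /step_int; apply: eq_bigr => i _ /=.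
  by rewrite mul1r mulN1r.
move=> ->; congr (normal_law _ _ _); rewrite sumE /step_variance.
apply: eq_bigr => i _; rewrite !sumE -big_split; apply: eq_bigr => j _ /=.
by rewrite /overlap; ring.
Qed.

Lemma integral_overlap t (i j : R * R) : 0 <= i.1 -> i.1 <= i.2 -> i.2 <= t ->
  0 <= j.1 -> j.1 <= j.2 -> j.2 <= t ->
  leb.-integrable `[0, t] (EFin \o (fun s => \1_(`]i.1, i.2]) s * \1_(`]j.1, j.2]) s)) /\
  \int[leb]_(s in `[0, t]) (\1_(`]i.1, i.2]) s * \1_(`]j.1, j.2]) s) = overlap i j.
Proof.
move=> i0 i12 it j0 j12 jt.
pose A := [set` `]Num.max i.1 j.1, Num.min i.2 j.2] ].
have -> : (fun s : R => \1_(`]i.1, i.2]) s * \1_(`]j.1, j.2]) s) = \1_A :> (R -> R).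
  apply/funext => s; rewrite !indicE -natrM mulnb; congr (nat_of_bool _)%:R.
  apply/andP/idP; rewrite !inE /A /= !in_itv/= gt_max le_min.
    by move=> [/andP[-> ->] /andP[-> ->]].
  by move=> /andP[/andP[-> ->] /andP[-> ->]].
have mA : measurable A by exact: measurable_itv.
have sA : A `&` `[0, t] = A.
  apply/setIidPl => s; rewrite /A /= !in_itv/= gt_max le_min => /andP[/andP[a b] /andP[c e]].
  by apply/andP; split; lra.
have lA : leb A = if Num.max i.1 j.1 < Num.min i.2 j.2 then
    (Num.min i.2 j.2 - Num.max i.1 j.1)%:E else 0%E.
  by rewrite /A lebesgue_measure_itv/= lte_fin.
split.
  apply/integrableP; split; first exact/measurable_EFinP/measurable_indic.
  under eq_integral do rewrite /= ger0_norm ?ler0n//.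
  apply: (le_lt_trans (_ : _ <= leb A)%E); first by rewrite integral_indic// sA.
  by rewrite lA; case: ifP => // _; rewrite ltry.
transitivity (fine (leb A)); first by rewrite /Rintegral integral_indic// sA.
rewrite lA /overlap.
have -> (b : bool) (x y : R) : fine (if b then (x - y)%:E else 0)%E = if b then x - y else 0.
  by case: b.
rewrite /Num.min /Num.max; repeat case: ifPn; rewrite -?leNgt /= => *; lra.
Qed.

(** The Ito isometry for step functions. *)
Lemma step_fun_integral t p : valid_step t p ->
  leb.-integrable `[0, t] (EFin \o (fun s => `|step_fun p s| ^+ 2)) /\
  \int[leb]_(s in `[0, t]) (`|step_fun p s| ^+ 2) = step_variance p.
Proof.
move=> vp.
have mI : measurable (`[0, t]%classic : set R) by exact: measurable_itv.
pose F (i j : R * R * H) (s : R) : R := ip i.2 j.2 * (\1_(`]i.1.1, i.1.2]) s * \1_(`]j.1.1, j.1.2]) s).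
have -> : (fun s => `|step_fun p s| ^+ 2) = (fun s => \sum_(i <- p) \sum_(j <- p) F i j s).
  apply/funext => s; rewrite hH /step_fun ip_suml; apply: eq_bigr => i _.
  rewrite ip_sumr; apply: eq_bigr => j _.
  by rewrite ipZl ipZr /F; ring.
have Fij i j : i \in p -> j \in p -> leb.-integrable `[0, t] (EFin \o F i j) /\
    \int[leb]_(s in `[0, t]) F i j s = overlap i.1 j.1 * ip i.2 j.2.
  move=> /(allP vp)/and3P[i0 i12 it] /(allP vp)/and3P[j0 j12 jt].
  have [ii ei] := integral_overlap i0 i12 it j0 j12 jt.
  rewrite RintegralZl// ei mulrC; split=> //.
  exact: integrable_scale.
have Fi i : i \in p -> leb.-integrable `[0, t] (EFin \o (fun s => \sum_(j <- p) F i j s)) /\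
    \int[leb]_(s in `[0, t]) (\sum_(j <- p) F i j s) = \sum_(j <- p) overlap i.1 j.1 * ip i.2 j.2.
  move=> ip_; have [|ij ej] := @Rintegral_sum_seq _ _ _ leb _ p `[0, t]%classic (F i) mI.
    by move=> j jp; have [] := Fij i j ip_ jp.
  split=> //; rewrite ej; apply: eq_big_seq => j jp; by have [] := Fij i j ip_ jp.
have [|i1 e1] := @Rintegral_sum_seq _ _ _ leb _ p `[0, t]%classic (fun i s => \sum_(j <- p) F i j s) mI.
  by move=> i ip_; have [] := Fi i ip_.
split=> //; rewrite e1 /step_variance; apply: eq_big_seq => i ip_; by have [] := Fi i ip_.
Qed.

Lemma step_variance_ge0 t p : valid_step t p -> 0 <= step_variance p.
Proof.
by move=> vp; have [_ <-] := step_fun_integral vp; apply: Rintegral_ge0 => s _; exact: sqr_ge0.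
Qed.

Lemma cos_step_int t p a : valid_step t p ->
  \int[P]_w cos (step_int W p w + a) = cos a * expR (- step_variance p / 2).
Proof.
move=> vp; apply: normal_law_cos.
- apply: measurable_sum => i; exact: measurable_funB.
- exact: step_variance_ge0 vp.
- exact: step_int_law vp.
Qed.

Lemma cos_lipschitz (x y : R) : `|cos x - cos y| <= `|x - y|.
Proof.
wlog xy : x y / x <= y.
  by move=> h; have [/h//|/ltW/h] := leP x y; rewrite distrC [leRHS]distrC.
have dc z : z \in `]x, y[ -> is_derive z 1 (@cos R) (- sin z) by move=> _; exact: is_derive_cos.
have [c _ E] := MVT_segment xy dc (continuous_subspaceT (@continuous_cos R)).
by rewrite distrC E normrM normrN [leRHS]distrC ler_piMl// sin_max.
Qed.

Section wiener_integral.
Variables (t : R) (f : R -> H) (X : Omega -> R).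
Hypothesis mX : measurable_fun setT X.
Hypothesis mf : forall h, measurable_fun `[0, t] (fun s => ip (f s) h).
Hypothesis fi : leb.-integrable `[0, t] (EFin \o (fun s => `|f s| ^+ 2)).
Hypothesis fX : is_wiener_integral W t f X.

Let v := \int[leb]_(s in `[0, t]) (`|f s| ^+ 2).

(** Norms converge along an L^2 approximation, since
    ||x|^2 - |y|^2| <= k |x|^2 + (1 + 1/k) |x - y|^2 for every k > 0. *)
Lemma step_variance_cvg (p : nat -> seq (R * R * H)) : (forall n, valid_step t (p n)) ->
  (\int[leb]_(s in `[0%R, t]) (`|f s - step_fun (p n) s| ^+ 2)%:E)%E @[n --> \oo] --> 0%E ->
  step_variance (p n) @[n --> \oo] --> v.
Proof.
move=> vp pl.
have mI : measurable (`[0, t]%classic : set R) by exact: measurable_itv.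
have mstep n : measurable_fun `[0, t] (fun s => ip (f s) (step_fun (p n) s)).
  have -> : (fun s => ip (f s) (step_fun (p n) s)) =
     (fun s => \sum_(i <- p n) (\1_(`]i.1.1, i.1.2]) s * ip (f s) i.2)).
    by apply/funext => s; rewrite /step_fun ip_sumr; apply: eq_bigr => i _; rewrite ipZr.
  by apply: measurable_sum => i; apply: measurable_funM.
have di n : leb.-integrable `[0, t] (EFin \o (fun s => `|f s - step_fun (p n) s| ^+ 2)).
  have [si _] := step_fun_integral (vp n).
  have msq : measurable_fun `[0, t] (fun s => `|f s - step_fun (p n) s| ^+ 2).
    have -> : (fun s => `|f s - step_fun (p n) s| ^+ 2) =
        (fun s => `|f s| ^+ 2 - 2 * ip (f s) (step_fun (p n) s) + `|step_fun (p n) s| ^+ 2).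
      by apply/funext => s; rewrite (normD_sqr hH) ipNr normrN mulr2n; ring.
    apply: measurable_funD; first apply: measurable_funB.
    + by have /integrableP[/measurable_EFinP] := fi.
    + exact: measurable_funM.
    + by have /integrableP[/measurable_EFinP] := si.
  have i2 : leb.-integrable `[0, t] (EFin \o (fun s => 2 * `|f s| ^+ 2 + (1 * `|step_fun (p n) s| ^+ 2 + `|step_fun (p n) s| ^+ 2))).
    by do 2 (apply: integrable_linear => //).
  apply: le_integrable i2 => //; first exact/measurable_EFinP.
  move=> s _; rewrite /= lee_fin ger0_norm ?sqr_ge0//; apply: le_trans (ler_norm _).
  have := sqr_ge0 `|f s + step_fun (p n) s|.
  rewrite !(normD_sqr hH) ipNr normrN; lra.
pose del n := \int[leb]_(s in `[0, t]) (`|f s - step_fun (p n) s| ^+ 2).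
have dl : del n @[n --> \oo] --> 0 by exact: (fine_cvg pl).
have v0 : 0 <= v by apply: Rintegral_ge0 => s _; exact: sqr_ge0.
apply/cvgrPdist_le => e e0.
(* k is chosen so that k v <= e / 2. *)
pose k := e / (2 * (v + 1)).
have k0 : 0 < k by rewrite divr_gt0// mulr_gt0// ltr_wpDl.
pose c := 1 + k^-1.
have c0 : 0 < c by rewrite addr_gt0// invr_gt0.
have /cvgr0_norm_lt/(_ (e / 2 / c)) := dl.
rewrite !divr_gt0// => /(_ isT); apply: filterS => n /ltr_normlP[_ dn].
have [si <-] := step_fun_integral (vp n).
rewrite /v -RintegralB//.
apply: le_trans (le_normr_Rintegral _ _) _ => //; first exact: integrable_sub.
apply: le_trans (_ : \int[leb]_(s in `[0, t]) (k * `|f s| ^+ 2 + c * `|f s - step_fun (p n) s| ^+ 2) <= _).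
  have icd : leb.-integrable `[0, t] (EFin \o (fun s => c * `|f s - step_fun (p n) s| ^+ 2)).
    exact: integrable_scale.
  apply: le_Rintegral => //.
  - by apply: integrable_norm => //; exact: integrable_sub.
  - exact: integrable_linear.
  - move=> s _.
    set x := f s; set y := step_fun (p n) s.
    have E : `|x| ^+ 2 - `|y| ^+ 2 = 2 * ip x (x - y) - `|x - y| ^+ 2.
      by rewrite (normD_sqr hH) ipNr normrN ipBr -hH mulr2n; ring.
    rewrite E (le_trans (ler_normB _ _))// normrM (ger0_norm (sqr_ge0 _)) (ger0_norm (_ : 0 <= 2))//.
    have cs := cauchy_schwarz hH x (x - y).
    have h : 0 <= k^-1 * (k * `|x| - `|x - y|) ^+ 2 by rewrite mulr_ge0 ?sqr_ge0// invr_ge0 ltW.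
    have E2 : k^-1 * (k * `|x| - `|x - y|) ^+ 2 = k * `|x| ^+ 2 - 2 * (`|x| * `|x - y|) + k^-1 * `|x - y| ^+ 2.
      by field; rewrite gt_eqF.
    rewrite E2 in h; rewrite /c mulrDl mul1r; lra.
rewrite Rintegral_linear//; last first.
  exact: integrable_scale.
rewrite RintegralZl// -/v -/(del n).
have h1 : k * v <= e / 2.
  rewrite /k invfM mulrA -mulrA ler_piMr ?divr_ge0 ?(ltW e0)//.
  by rewrite mulrC ler_pdivrMr ?ltr_wpDl// mul1r lerDl.
have h2 : c * del n <= e / 2 by rewrite -ler_pdivlMl// mulrC ltW.
lra.
Qed.

(** For step functions this is the characteristic function of a normal variable. The
    cosine is Lipschitz, so expectations pass to the limit, and so do the variances. *)
Lemma cos_wiener_integral a : \int[P]_w cos (X w + a) = cos a * expR (- v / 2).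
Proof.
have [p [vp pf pX]] := fX.
have vl := step_variance_cvg vp pf.
have l1 : cos a * expR (- step_variance (p n) / 2) @[n --> \oo] --> cos a * expR (- v / 2).
  apply: cvgMr; apply: continuous_cvg; first exact: continuous_expR.
  by apply: cvgMl; exact: cvgN.
have mcos : measurable_fun setT (fun x : R => cos (x + a)).
  have := @measurable_cos_affine R a 1.
  by under eq_fun do rewrite mul1r.
have icos (Y : Omega -> R) : measurable_fun setT Y -> P.-integrable setT (EFin \o (fun w => cos (Y w + a))).
  move=> mY; apply: (le_integrable measurableT (g := EFin \o cst 1)).
  - by apply/measurable_EFinP; exact: (measurableT_comp mcos mY).
  - by move=> x _; rewrite lee_fin normr1 cos_max.
  - exact: finite_measure_integrable_cst.
have mXn n : measurable_fun setT (step_int W (p n)).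
  by apply: measurable_sum => i; exact: measurable_funB.
have l2 : \int[P]_w cos (step_int W (p n) w + a) @[n --> \oo] --> \int[P]_w cos (X w + a).
  apply/cvgrPdist_le => e e0.
  have e2 : (0 < (e ^+ 2)%:E)%E by rewrite lte_fin exprn_gt0.
  have near_lt : \forall n \near \oo,
     (\int[P]_w ((X w - step_int W (p n) w) ^+ 2)%:E < (e ^+ 2)%:E)%E.
    move/fine_cvgP : pX => [fin /cvgr0_norm_lt/(_ _ (exprn_gt0 2 e0))].
    move: fin; apply: filterS2 => n fin /ltr_normlP[_ lt].
    by rewrite -(fineK fin) lte_fin.
  move: near_lt; apply: filterS => n hn.
  have msq : measurable_fun setT (fun w => (X w - step_int W (p n) w) ^+ 2).
    by apply: measurable_funX; exact: measurable_funB.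
  have isq : P.-integrable setT (EFin \o (fun w => (X w - step_int W (p n) w) ^+ 2)).
    apply/integrableP; split; first exact/measurable_EFinP.
    apply: le_lt_trans (lt_trans hn (ltry _)).
    by under eq_integral do rewrite /= ger0_norm ?sqr_ge0//.
  rewrite -RintegralB//; [|exact: icos..].
  apply: le_trans (le_normr_Rintegral measurableT (integrable_sub measurableT (icos _ mX) (icos _ (mXn n)))) _.
  have ic := finite_measure_integrable_cst P (e / 2) measurableT.
  apply: le_trans (_ : \int[P]_w ((2 * e)^-1 * (X w - step_int W (p n) w) ^+ 2 + e / 2) <= _).
    apply: le_Rintegral => //.
    - by have := integrable_norm (integrable_sub measurableT (icos _ mX) (icos _ (mXn n))); apply: eq_integrable.
    - exact: integrable_linear.
    - move=> w _; apply: le_trans (cos_lipschitz _ _) _.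
      rewrite [X in `|X|](_ : _ = X w - step_int W (p n) w); last by ring.
      set z := X w - _; rewrite -(real_normK (num_real z)).
      have : 0 <= (2 * e)^-1 * (`|z| - e) ^+ 2 by rewrite mulr_ge0 ?sqr_ge0// invr_ge0 mulr_ge0// ltW.
      have -> : (2 * e)^-1 * (`|z| - e) ^+ 2 = (2 * e)^-1 * `|z| ^+ 2 + e / 2 - `|z| by field; rewrite gt_eqF.
      by rewrite subr_ge0.
  rewrite Rintegral_linear// Rintegral_cst// [fine _](_ : _ = 1); last by rewrite /= probability_setT.
  have : \int[P]_w ((X w - step_int W (p n) w) ^+ 2) <= e ^+ 2.
    rewrite -lee_fin /Rintegral fineK; first exact: ltW.
    exact: integrable_fin_num.
  move=> h; have : (2 * e)^-1 * \int[P]_w ((X w - step_int W (p n) w) ^+ 2) <= e / 2.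
    rewrite ler_pdivrMl ?mulr_gt0//; apply: le_trans h _.
    by rewrite le_eqVlt; apply/orP; left; apply/eqP; field.
  by lra.
have E : (fun n => \int[P]_w cos (step_int W (p n) w + a)) =
    (fun n => cos a * expR (- step_variance (p n) / 2)).
  by apply/funext => n; exact: cos_step_int (vp n).
rewrite E in l2; rewrite -(cvg_lim _ l2)//; exact: cvg_lim l1.
Qed.

End wiener_integral.
End wiener.

(** * The stationary covariance *)

Section covariance.
Context {R : realType} (H : completeNormedModType R) (ip : {dot H for idfun}).
Hypothesis hH : is_hilbert ip.
Variable S : R -> {linear H -> H}.
Hypothesis hS : C0_semigroup S.
Variable Q : {linear H -> H}.
Hypotheses (hQ : continuous Q) (hQsa : selfadjoint ip Q) (hQ0 : nonnegative_op ip Q).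
Hypothesis hinj : injective (Qinf ip S Q).
Implicit Types (x y z h k : H) (s t r : R).
Local Notation leb := (@lebesgue_measure R).
Local Notation Sa := (Sadj ip S).

Definition qdens h k s : R := ip (S s (Q (Sa s h))) k.
Definition qcov h k : R := ip (Qinf ip S Q h) k.
(** <Q_t h, k>, where Q_t is the covariance of the stochastic convolution at time t. *)
Definition qcov_upto t h k : R := \int[leb]_(s in `[0, t]) qdens h k s.

Lemma qdensE h k s : 0 <= s -> qdens h k s = ip (Q (Sa s h)) (Sa s k).
Proof. by move=> s0; rewrite /qdens SadjP. Qed.

(** The integral which defines Qinf h exists. If it did not, Qinf h would have the
    default value 0 = Qinf 0, so that h = 0 by injectivity; but the integral exists for
    h = 0. *)
Lemma Qinf_spec h k : leb.-integrable `[0, +oo[ (EFin \o qdens h k) /\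
  qcov h k = \int[leb]_(s in `[0, +oo[) qdens h k s.
Proof.
pose Sp h := [set y | forall k, leb.-integrable `[0%R, +oo[ (fun s => (qdens h k s)%:E) /\
  ip y k = \int[leb]_(s in `[0, +oo[) qdens h k s].
have Sp0 : Sp 0 0.
  move=> k'.
  have z s : s \in (`[0, +oo[%classic : set R) -> qdens 0 k' s = 0.
    rewrite inE/= in_itv/= andbT => s0.
    have -> : qdens 0 k' s = ip (Q (Sa s 0)) (Sa s k') by rewrite qdensE.
    have -> : Sa s 0 = 0 by apply: (ip_ext hH) => w; rewrite (SadjPr hH hS)// !ip0l.
    by rewrite linear0 ip0l.
  split; last first.
    rewrite ip0l; apply/esym; transitivity (\int[leb]_(s in `[0%R, +oo[) (0 : R)).
      by apply: eq_Rintegral => s /z.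
    by rewrite Rintegral_cst ?mul0r.
  have := @integrable0 _ _ _ leb `[0, +oo[%classic.
  by apply: eq_integrable => // s sD; rewrite z.
have Q0 : Qinf ip S Q 0 = 0.
  have /= := xgetPex 0 (ex_intro (Sp 0) 0 Sp0).
  rewrite -/(Qinf ip S Q 0) => h0.
  apply: (ip_ext hH) => y; have [_ ->] := h0 y; have [_ <-] := Sp0 y; by rewrite ip0l.
have [ex|nex] := pselect (exists y, Sp h y).
  by have /(_ k) := xgetPex 0 ex.
suff h0 : h = 0 by exfalso; apply: nex; exists 0; rewrite h0.
apply: hinj; rewrite Q0; apply: xgetPN => y Sy; by apply: nex; exists y.
Qed.

Lemma qdens_integrable h k : leb.-integrable `[0, +oo[ (EFin \o qdens h k).
Proof. by have [] := Qinf_spec h k. Qed.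

Lemma qcovE h k : qcov h k = \int[leb]_(s in `[0, +oo[) qdens h k s.
Proof. by have [] := Qinf_spec h k. Qed.

Lemma qdens_integrable_itv t h k : leb.-integrable `[0, t] (EFin \o qdens h k).
Proof.
by apply: integrableS (qdens_integrable h k) => //; apply: subset_itvl; rewrite bnd_simp.
Qed.

Lemma qcov_sym h k : qcov h k = qcov k h.
Proof.
rewrite !qcovE; apply: eq_Rintegral => s; rewrite inE/= in_itv/= andbT => s0.
by rewrite !qdensE// hQsa ipC.
Qed.

Lemma qcov_ge0 h : 0 <= qcov h h.
Proof.
rewrite qcovE; apply: Rintegral_ge0 => s; rewrite /= in_itv/= andbT => s0.
by rewrite qdensE.
Qed.

(** The invariance of mu: Qinf = Q_t + S(t) Qinf S*(t), by a translation of the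
    variable of integration. *)
Lemma qcov_split t h k : 0 <= t ->
  qcov h k = qcov_upto t h k + qcov (Sa t h) (Sa t k).
Proof.
move=> t0.
have ig := qdens_integrable h k.
have := @Rintegral_itvB R (qdens h k) (BLeft 0) +oo%O t ig; rewrite !bnd_simp => /(_ t0 isT).
have ig' : leb.-integrable `]t, +oo[ (EFin \o qdens h k).
  by apply: integrableS ig => //; apply: subset_itvr; rewrite bnd_simp.
have ig2 : leb.-integrable `[t, +oo[ (EFin \o qdens h k).
  by apply: integrableS ig => //; apply: subset_itvr; rewrite bnd_simp.
rewrite Rintegral_itv_obnd_cbnd// => E.
rewrite qcovE /qcov_upto; apply/eqP; rewrite addrC -subr_eq; apply/eqP.
rewrite E qcovE.
have [_ E2] := @Rintegral_shift R t `[t, +oo[%classic (qdens h k) (measurable_itv _) ig2.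
apply: etrans (esym E2) _.
have -> : ((fun x : R => x + t) @^-1` `[t, +oo[%classic) = `[0, +oo[%classic.
  by apply/seteqP; split=> x /=; rewrite !in_itv/= !andbT; lra.
apply: eq_Rintegral => s; rewrite inE/= in_itv/= andbT => s0.
by rewrite !qdensE ?addr_ge0// !SadjD.
Qed.

Lemma qcov_quad h k : qcov (h + k) (h + k) = qcov h h + 2 * qcov h k + qcov k k.
Proof.
have D x y z : qcov (x + y) z = qcov x z + qcov y z by rewrite !(qcov_sym _ z) /qcov ipDr.
by rewrite D /qcov !ipDr -/(qcov h h) -/(qcov h k) -/(qcov k h) -/(qcov k k) (qcov_sym k h); ring.
Qed.

Lemma qcov_quadN h k : qcov (h - k) (h - k) = qcov h h - 2 * qcov h k + qcov k k.
Proof.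
have N x z : qcov (- x) z = - qcov x z by rewrite !(qcov_sym _ z) /qcov ipNr.
by rewrite qcov_quad N !(qcov_sym _ (- k)) !N (qcov_sym k h); ring.
Qed.

(** S(s) Q S*(s) S*(t) = S(s) Q S*(t) S*(s) = S(t) S(s) Q S*(s), under the integral. *)
Lemma intertwine_qcov : (forall t, 0 <= t -> forall x, S t (Q x) = Q (Sa t x)) ->
  forall t h k, 0 <= t -> qcov (Sa t h) k = qcov h (Sa t k).
Proof.
move=> SQ t h k t0; rewrite !qcovE; apply: eq_Rintegral => s; rewrite inE/= in_itv/= andbT => s0.
rewrite !qdensE// -SadjD// addrC SadjD// -SQ// SadjP//.
by rewrite -!SadjD// addrC.
Qed.

(** The curve S*(s) h is only weakly continuous in s, but S*(s) k -> k in norm for k in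
    the domain of A*: this is enough for <Q S*(s) h, S*(s) k> to converge as s -> 0. *)
Lemma qcov_upto_deriv h k z : adj_gen ip S k z ->
  t^-1 * qcov_upto t h k @[t --> 0^'+] --> ip (Q h) k.
Proof.
move=> kz; have [M M0 MP] := semigroup_locally_bounded hS 1.
have [q q0 qP] := continuous_op_bounded hQ.
apply/cvgrPdist_le => e e0.
pose c1 := q * (M * `|h|) * (M * `|z|) + 1.
have c10 : 0 < c1 by rewrite ltr_wpDl// !mulr_ge0// ltW.
pose e1 := e / 2 / (`|h| + 1).
have e10 : 0 < e1 by rewrite !divr_gt0// ltr_wpDl.
have [d d0 dP] := semigroup_near0 hS (Q k) e10.
pose d1 := Num.min (Num.min d 1) (e / 2 / c1).
have d10 : 0 < d1 by rewrite !lt_min d0 ltr01 !divr_gt0.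
exists d1 => //= t; rewrite /ball_/= sub0r normrN => td t0.
rewrite gtr0_norm// /d1 !lt_min in td; move/andP: td => [/andP[td t1] tc].
have ig := qdens_integrable_itv t h k.
have -> : ip (Q h) k - t^-1 * qcov_upto t h k = t^-1 * \int[leb]_(s in `[0, t]) (ip (Q h) k - qdens h k s).
  rewrite RintegralB//; last exact: integrable_cst_itv.
  by rewrite Rintegral_cst_itv ?(ltW t0)// mulrBr mulKf ?gt_eqF.
rewrite normrM gtr0_norm ?invr_gt0// ler_pdivrMl//.
apply: Rintegral_le_itv; [exact: ltW| |].
  by apply: integrable_sub => //; exact: integrable_cst_itv.
move=> s /andP[s0 st].
have s1 : s <= 1 by lra.
rewrite qdensE//.
have -> : ip (Q h) k - ip (Q (Sa s h)) (Sa s k) =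
   - (ip (Q (Sa s h)) (Sa s k - k) + ip h (S s (Q k) - Q k)).
  rewrite !ipBr -(SadjPr hH hS)// !hQsa; ring.
rewrite normrN (le_trans (ler_normD _ _))// (splitr e); apply: lerD.
  apply: le_trans (cauchy_schwarz hH _ _) _.
  have a1 : `|Q (Sa s h)| <= q * (M * `|h|).
    apply: le_trans (qP _) _; rewrite ler_wpM2l ?(ltW q0)//.
    by apply: Sadj_le => // w; apply: MP; rewrite s0.
  have a2 : `|Sa s k - k| <= s * M * `|z|.
    by apply: (Sadj_lipschitz hH hS _ (ltW M0) _ kz) => // w /andP[w0 ws]; apply: MP; lra.
  apply: le_trans (ler_pM _ _ a1 a2) _ => //.
  have sc : s * c1 <= e / 2.
    by rewrite -ler_pdivlMr//; lra.
  apply: le_trans sc; rewrite /c1 -mulrA mulrCA ler_wpM2l//.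
  by rewrite mulrA -[leLHS]addr0 lerD.
apply: le_trans (cauchy_schwarz hH _ _) _.
have sd : `|S s (Q k) - Q k| <= e1 by apply/ltW/dP; lra.
apply: le_trans (ler_wpM2l (normr_ge0 h) sd) _.
rewrite /e1 mulrA ler_pdivrMr ?ltr_wpDl// mulrC ler_wpM2l ?lerDl//.
by rewrite divr_ge0// ltW.
Qed.

(** The symmetry passes from Qinf to Q_t by [qcov_split]. For k in the domain of A*,
    divide <Q_t S*(r) h, k> = <Q_t h, S*(r) k> by t and let t tend to 0. *)
Lemma qcov_intertwine :
  (forall t h k, 0 <= t -> qcov (Sa t h) k = qcov h (Sa t k)) ->
  forall t, 0 <= t -> forall x, S t (Q x) = Q (Sa t x).
Proof.
move=> qS r r0 h; apply: (adj_gen_dense hH hS) => k z kz.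
have qt t : 0 <= t -> qcov_upto t (Sa r h) k = qcov_upto t h (Sa r k).
  move=> t0; have E1 := qcov_split (Sa r h) k t0; have E2 := qcov_split h (Sa r k) t0.
  have C x : Sa t (Sa r x) = Sa r (Sa t x) by rewrite -!(SadjD hH hS)// addrC.
  by move: E1; rewrite (qS r)// E2 !C (qS r (Sa t h))// => /addIr.
have l1 := @qcov_upto_deriv (Sa r h) _ _ kz.
have l2 := @qcov_upto_deriv h _ _ (adj_gen_Sadj hH hS r0 kz).
have E : ip (Q (Sa r h)) k = ip (Q h) (Sa r k).
  rewrite -(cvg_lim _ l1)//; apply: cvg_lim => //.
  apply: cvg_trans l2; apply: near_eq_cvg; near=> t.
  by have t0 : 0 <= t by []; rewrite qt.
by rewrite [RHS]ipC E [RHS]ipC (SadjPr hH hS).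
Unshelve. all: by end_near.
Qed.

End covariance.

(** * Symmetric contractions and trigonometric functions *)

Section symmetric_L2.
Context {R : realType} (H : completeNormedModType R) (ip : {dot H for idfun}).
Hypotheses (hH : is_hilbert ip) (hsep : separable_space H).
Variable mu : probability (borel H) R.
Variable T : (borel H -> R) -> (borel H -> R).
Hypothesis TL2 : forall f, L2 mu f -> L2 mu (T f).
Hypothesis Tlin : forall a f g, L2 mu f -> L2 mu g ->
  {ae mu, forall x, T (fun y => a * f y + g y) x = a * T f x + T g x}.
Hypothesis Tcontr : forall f, L2 mu f ->
  \int[mu]_x (T f x ^+ 2) <= \int[mu]_x (f x ^+ 2).

Lemma pairing_linear a f g1 g2 : L2 mu f -> L2 mu g1 -> L2 mu g2 ->
  \int[mu]_x (f x * (a * g1 x + g2 x)) = a * \int[mu]_x (f x * g1 x) + \int[mu]_x (f x * g2 x).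
Proof.
move=> Lf L1 L2'; rewrite -Rintegral_linear//; [|exact: L2_mul..].
by apply: eq_Rintegral => x _; ring.
Qed.

Lemma pairing_T_linear a f g1 g2 : L2 mu f -> L2 mu g1 -> L2 mu g2 ->
  \int[mu]_x (f x * T (fun y => a * g1 y + g2 y) x) =
  a * \int[mu]_x (f x * T g1 x) + \int[mu]_x (f x * T g2 x).
Proof.
move=> Lf L1 L2'; rewrite -pairing_linear//; [|exact: TL2..].
apply: ae_Rintegral.
- by apply: measurable_funM; [exact: Lf.1|exact: (TL2 (L2_linear a L1 L2')).1].
- by apply: measurable_funM; [exact: Lf.1|exact: (L2_linear a (TL2 L1) (TL2 L2')).1].
- by move: (Tlin a L1 L2'); apply: filterS => x ->.
Qed.

Lemma pairing_cvg f (g_ : nat -> borel H -> R) g : L2 mu f -> (forall n, L2 mu (g_ n)) -> L2 mu g ->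
  \int[mu]_x ((g_ n x - g x) ^+ 2) @[n --> \oo] --> 0 ->
  \int[mu]_x (f x * g_ n x) @[n --> \oo] --> \int[mu]_x (f x * g x).
Proof.
move=> Lf Lg_ Lg gl.
have h := L2_pairing_cvg0 Lf (fun n => L2_sub (Lg_ n) Lg) gl.
have E n : \int[mu]_x (f x * (g_ n x - g x)) = \int[mu]_x (f x * g_ n x) - \int[mu]_x (f x * g x).
  rewrite -RintegralB//; [|exact: L2_mul..].
  by apply: eq_Rintegral => x _; rewrite mulrBr.
apply/subr_cvg0; under eq_fun do rewrite -E; exact: h.
Qed.

(** T g_n - T g = T (g_n - g) almost everywhere. *)
Lemma contraction_L2_cvg (g_ : nat -> borel H -> R) g : (forall n, L2 mu (g_ n)) -> L2 mu g ->
  \int[mu]_x ((g_ n x - g x) ^+ 2) @[n --> \oo] --> 0 ->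
  \int[mu]_x ((T (g_ n) x - T g x) ^+ 2) @[n --> \oo] --> 0.
Proof.
move=> Lg_ Lg gl.
apply: (@squeeze_cvgr _ _ _ _ (cst 0) _ _ _ _ _ gl); last exact: cvg_cst.
apply: nearW => n; apply/andP; split.
  by apply: Rintegral_ge0 => x _; exact: sqr_ge0.
have := Tcontr (L2_linear (-1) Lg (Lg_ n)).
rewrite [X in _ <= X -> _](_ : _ = \int[mu]_x ((g_ n x - g x) ^+ 2)); last first.
  by apply: eq_Rintegral => x _; congr (_ ^+ 2); rewrite mulN1r addrC.
apply: le_trans; rewrite le_eqVlt; apply/orP; left; apply/eqP; apply: ae_Rintegral.
- by apply: measurable_funX; apply: measurable_funB; [exact: (TL2 (Lg_ n)).1|exact: (TL2 Lg).1].
- by apply: measurable_funX; exact: (TL2 (L2_linear (-1) Lg (Lg_ n))).1.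
- by move: (Tlin (-1) Lg (Lg_ n)); apply: filterS => x ->; congr (_ ^+ 2); rewrite mulN1r addrC.
Qed.

Definition symmetric_pair f g := \int[mu]_x (T f x * g x) = \int[mu]_x (f x * T g x).

Lemma symmetric_pairC f g : symmetric_pair f g -> symmetric_pair g f.
Proof.
rewrite /symmetric_pair => E.
by under eq_Rintegral do rewrite mulrC; rewrite -E; apply: eq_Rintegral => x _; rewrite mulrC.
Qed.

(** For a fixed f the functions g which satisfy the symmetry relation with f form a
    closed subspace of L^2(mu). *)
Lemma symmetric_pair_trig f : L2 mu f ->
  (forall h a, symmetric_pair f (fun x => cos (ip x h + a))) ->
  forall g, L2 mu g -> symmetric_pair f g.
Proof.
move=> Lf fcos; apply: (L2_trig_dense hH hsep) => //.
- move=> a g1 g2 L1 L2' S1 S2; rewrite /symmetric_pair pairing_T_linear//.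
  by rewrite pairing_linear ?S1 ?S2//; exact: TL2.
- move=> g_ g Lg_ Lg S_ gl; rewrite /symmetric_pair.
  have l1 := pairing_cvg (TL2 Lf) Lg_ Lg gl.
  have l2 := pairing_cvg Lf (fun n => TL2 (Lg_ n)) (TL2 Lg) (contraction_L2_cvg Lg_ Lg gl).
  rewrite -(cvg_lim _ l1)//; apply: cvg_lim => //.
  by move: l2; under eq_fun do rewrite -S_.
Qed.

(** [symmetric_pair_trig] is used twice, the first time for f a cosine. *)
Lemma symmetric_of_trig :
  (forall h a k b, symmetric_pair (fun x => cos (ip x h + a)) (fun x => cos (ip x k + b))) ->
  forall f g, L2 mu f -> L2 mu g -> symmetric_pair f g.
Proof.
move=> ccos f g Lf Lg.
have Lcos h a : L2 mu (fun x => cos (ip x h + a)).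
  by apply: (trig_closed_L2 hH); exact: trig_cos.
apply: symmetric_pair_trig => // h a; apply: symmetric_pairC.
exact: symmetric_pair_trig.
Qed.

End symmetric_L2.

(** * The Ornstein-Uhlenbeck semigroup *)

Section ornstein_uhlenbeck.
Context {R : realType} (H : completeNormedModType R) (ip : {dot H for idfun}).
Hypotheses (hH : is_hilbert ip) (hsep : separable_space H).
Variable Q : {linear H -> H}.
Hypotheses (hQsa : selfadjoint ip Q) (hQ0 : nonnegative_op ip Q).
Variable S : R -> {linear H -> H}.
Hypothesis hS : C0_semigroup S.
Hypothesis hinj : injective (Qinf ip S Q).
Context d (Omega : measurableType d) (P : probability Omega R).
Variable W : R -> H -> {RV P >-> R}.
Hypothesis hW : cylindrical_wiener ip W.
Variable K : {linear H -> H}.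
Hypothesis hK : is_sqrt_op ip Q K.
Variable I : R -> {mfun Omega >-> borel H}.
Hypothesis hI : stochastic_convolution ip W S K I.
Variable mu : probability (borel H) R.
Hypothesis hmu : centered_gaussian ip mu (Qinf ip S Q).
Implicit Types (x y z h k : H) (s t r a b : R).
Local Notation leb := (@lebesgue_measure R).
Local Notation Sa := (Sadj ip S).
Local Notation q := (qcov ip S Q).
Local Notation qt := (qcov_upto ip S Q).

Lemma cos_gaussian h a : \int[mu]_x cos (ip x h + a) = cos a * expR (- q h h / 2).
Proof.
apply: (normal_law_cos (X := fun x : borel H => ip x h)).
- exact: ip_measurable.
- exact: qcov_ge0.
- by move=> B mB; exact: hmu.
Qed.

(** <I(t), h> is the Wiener integral of K S*(t - s) h, and
    |K S*(t - s) h|^2 = <Q S*(t - s) h, S*(t - s) h>. *)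
Lemma cos_convolution t h a : 0 <= t ->
  \int[P]_w cos (ip (I t w) h + a) = cos a * expR (- qt t h h / 2).
Proof.
move=> t0; have [cK saK _ KQ] := hK.
have ig := qdens_integrable_itv hH hS hinj t h h.
have [ir er] := @Rintegral_reflect R t `[0, t]%classic (qdens ip S Q h h) (measurable_itv _) ig.
have pre : (fun x : R => t - x) @^-1` `[0, t]%classic = `[0, t]%classic.
  by apply/seteqP; split=> x /=; rewrite !in_itv/=; lra.
rewrite pre in ir er.
have normE s : 0 <= s <= t -> `|K (Sa (t - s) h)| ^+ 2 = qdens ip S Q h h (t - s).
  move=> /andP[s0 st]; have ts : 0 <= t - s by rewrite subr_ge0.
  by rewrite hH saK KQ (qdensE hH hS)// hQsa.
rewrite (@cos_wiener_integral _ _ _ hH _ _ _ _ hW t (fun s => K (Sa (t - s) h)) _ _ _ _ (hI t0 h)).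
- congr (_ * expR (- _ / 2)); rewrite /qcov_upto -er; apply: eq_Rintegral => s.
  by rewrite inE/= in_itv/=; exact: normE.
- exact: (measurableT_comp (ip_measurable hH h)).
- move=> k.
  have cS : measurable_fun `[0, t] (fun s : R => ip (S `|t - s| (K k)) h).
    apply: measurable_funTS; apply: continuous_measurable_fun => s.
    apply: (ip_cvgl hH) => //.
    apply: (@continuous_comp _ _ _ (fun s : R => t - s) (fun u : R => S `|u| (K k))).
      by apply: cvgB; [exact: cvg_cst|exact: cvg_id].
    exact: orbit_continuous.
  apply: eq_measurable_fun cS => s; rewrite inE/= in_itv/= => /andP[s0 st].
  have ts : 0 <= t - s by rewrite subr_ge0.
  by rewrite ger0_norm// saK (SadjPr hH hS)// ipC.
- by apply: eq_integrable ir => // s; rewrite inE/= in_itv/= => st; rewrite /= normE.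
Qed.

Lemma transition_cos t h a x : 0 <= t ->
  transition P (OU S I) t (fun y => cos (ip y h + a)) x =
  expR (- qt t h h / 2) * cos (ip x (Sa t h) + a).
Proof.
move=> t0; rewrite /transition unlock /OU.
have := cos_convolution h (ip (S t x) h + a) t0; rewrite /Rintegral => E.
transitivity (fine (\int[P]_w (cos (ip (I t w) h + (ip (S t x) h + a)))%:E)%E).
  by congr fine; apply: eq_integral => w _; rewrite ipDl addrCA addrA.
by rewrite E (SadjP hH hS)// mulrC.
Qed.

Variable T : R -> (borel H -> R) -> (borel H -> R).
Hypothesis hT : L2_extension mu (transition P (OU S I)) T.

Lemma extension_L2 t f : 0 <= t -> L2 mu f -> L2 mu (T t f).
Proof. by move=> t0 /Lfun2P Lf; apply/Lfun2P; have [h _ _ _] := hT t0; exact: h. Qed.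

Lemma extension_linear t a f g : 0 <= t -> L2 mu f -> L2 mu g ->
  {ae mu, forall x, T t (fun y => a * f y + g y) x = a * T t f x + T t g x}.
Proof. by move=> t0 /Lfun2P Lf /Lfun2P Lg; have [_ h _ _] := hT t0; exact: h. Qed.

Lemma extension_contraction t f : 0 <= t -> L2 mu f ->
  \int[mu]_x (T t f x ^+ 2) <= \int[mu]_x (f x ^+ 2).
Proof.
move=> t0 Lf; apply: Lnorm2_le_sqr => //; first exact: extension_L2.
by have [_ _ h _] := hT t0; apply/h/Lfun2P.
Qed.

Lemma extension_cos t h a : 0 <= t -> {ae mu, forall x, T t (fun y => cos (ip y h + a)) x =
  expR (- qt t h h / 2) * cos (ip x (Sa t h) + a)}.
Proof.
move=> t0; have [_ _ _ hb] := hT t0.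
have bb : bounded_borel (fun y : borel H => cos (ip y h + a)).
  by split; [exact: cos_ip_measurable|exists 1 => x; exact: cos_max].
by move: (hb _ bb); apply: filterS => x ->; rewrite transition_cos.
Qed.

(** Expand the product of the two cosines and use [qcov_split]: everything but
    <Qinf S*(t) h, k> enters through a factor which is symmetric in h and k. *)
Lemma pairing_cos t h a k b : 0 <= t ->
  \int[mu]_x (T t (fun y => cos (ip y h + a)) x * cos (ip x k + b)) =
  expR (- (q h h + q k k) / 2) / 2 *
    (cos (a + b) * expR (- q (Sa t h) k) + cos (a - b) * expR (q (Sa t h) k)).
Proof.
move=> t0.
have mc k' b' := cos_ip_measurable hH k' b'.
have ci k' b' : mu.-integrable setT (EFin \o (fun x : borel H => cos (ip x k' + b'))).
  apply: (le_integrable measurableT (g := EFin \o cst 1)).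
  - exact/measurable_EFinP.
  - by move=> x _; rewrite lee_fin normr1 cos_max.
  - exact: finite_measure_integrable_cst.
transitivity (\int[mu]_x (expR (- qt t h h / 2) / 2 * (1 * cos (ip x (Sa t h + k) + (a + b)) +
    cos (ip x (Sa t h - k) + (a - b))))).
  apply: ae_Rintegral.
  - apply: measurable_funM => //.
    have Lc : L2 mu (fun y => cos (ip y h + a)).
      by apply: (trig_closed_L2 hH); exact: trig_cos.
    by have [] := extension_L2 t0 Lc.
  - by apply: measurable_funM => //; apply: measurable_funD => //; apply: measurable_funM.
  - apply: (@filterS _ _ (ae_filter_ringOfSetsType mu) _ _ _ (extension_cos h a t0)) => x /= ->.
    rewrite ipDr ipBr.
    have -> : ip x (Sa t h) + ip x k + (a + b) = (ip x (Sa t h) + a) + (ip x k + b) by ring.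
    have -> : ip x (Sa t h) - ip x k + (a - b) = (ip x (Sa t h) + a) - (ip x k + b) by ring.
    by rewrite (cosD (_ + a)) (cosB (_ + a)); field.
rewrite RintegralZl//; last exact: integrable_linear.
rewrite Rintegral_linear// !cos_gaussian mul1r.
rewrite (qcov_quad hH hS hQsa hinj) (qcov_quadN hH hS hQsa hinj).
have E := qcov_split hH hS hinj h h t0.
have e1 : expR (- qt t h h / 2) * expR (- (q (Sa t h) (Sa t h) + 2 * q (Sa t h) k + q k k) / 2) =
   expR (- (q h h + q k k) / 2) * expR (- q (Sa t h) k).
  by rewrite -!expRD E; congr expR; field.
have e2 : expR (- qt t h h / 2) * expR (- (q (Sa t h) (Sa t h) - 2 * q (Sa t h) k + q k k) / 2) =
   expR (- (q h h + q k k) / 2) * expR (q (Sa t h) k).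
  by rewrite -!expRD E; congr expR; field.
transitivity ((cos (a + b) * (expR (- (q h h + q k k) / 2) * expR (- q (Sa t h) k)) +
   cos (a - b) * (expR (- (q h h + q k k) / 2) * expR (q (Sa t h) k))) / 2); last by ring.
by rewrite -e1 -e2; ring.
Qed.

Lemma symmetric_pair_cos t h a k b : 0 <= t ->
  (symmetric_pair mu (T t) (fun x => cos (ip x h + a)) (fun x => cos (ip x k + b))) <->
  cos (a + b) * expR (- q (Sa t h) k) + cos (a - b) * expR (q (Sa t h) k) =
  cos (a + b) * expR (- q (Sa t k) h) + cos (a - b) * expR (q (Sa t k) h).
Proof.
move=> t0; rewrite /symmetric_pair pairing_cos//.
have -> : \int[mu]_x (cos (ip x h + a) * T t (fun x => cos (ip x k + b)) x) =
  \int[mu]_x (T t (fun x => cos (ip x k + b)) x * cos (ip x h + a)).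
  by apply: eq_Rintegral => x _; rewrite mulrC.
rewrite pairing_cos// (addrC b a) (addrC (q k k)) -[b - a]opprB cosN.
split=> [|->//]; apply: mulfI.
by rewrite mulf_neq0// gt_eqF// expR_gt0.
Qed.

(** For a = b = pi / 4 the terms in cos(a + b) vanish, and the exponential is
    injective. *)
Lemma symmetric_qcov : L2_symmetric mu T ->
  forall t h k, 0 <= t -> q (Sa t h) k = q h (Sa t k).
Proof.
move=> Tsym t h k t0.
have Lc h' a : (fun x : borel H => cos (ip x h' + a)) \in Lfun mu 2%:E.
  by apply/Lfun2P; apply: (trig_closed_L2 hH); exact: trig_cos.
have := Tsym t t0 _ _ (Lc h (pi / 4)) (Lc k (pi / 4)).
move=> /(symmetric_pair_cos h (pi / 4) k (pi / 4) t0).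
have -> : pi / 4 + pi / 4 = pi / 2 :> R by field.
rewrite cos_pihalf subrr cos0 !mul0r !add0r !mul1r => /expR_inj ->.
by rewrite (qcov_sym hH hS hQsa hinj).
Qed.

Lemma qcov_symmetric :
  (forall t h k, 0 <= t -> q (Sa t h) k = q h (Sa t k)) -> L2_symmetric mu T.
Proof.
move=> qS t t0 f g /Lfun2P Lf /Lfun2P Lg.
apply: (symmetric_of_trig hH hsep (T := T t)) => //.
- by move=> u; exact: extension_L2.
- by move=> a u v; exact: extension_linear.
- by move=> u; exact: extension_contraction.
- move=> h a k b; apply/symmetric_pair_cos => //.
  by rewrite qS// (qcov_sym hH hS hQsa hinj).
Qed.

End ornstein_uhlenbeck.

Theorem theorem2p4 (R : realType) (H : completeNormedModType R)
  (ip : {dot H for idfun}) (hH : is_hilbert ip) (hsep : separable_space H)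
  (Q : {linear H -> H}) (hQ : continuous Q) (hQsa : selfadjoint ip Q)
  (hQ0 : nonnegative_op ip Q)
  (S : R -> {linear H -> H}) (hS : C0_semigroup S)
  (B : set H) (hB : orthonormal_basis ip B) (htr : finite_trace ip B S Q)
  (hinj : injective (Qinf ip S Q))
  (d : measure_display) (Omega : measurableType d) (P : probability Omega R)
  (W : R -> H -> {RV P >-> R}) (hW : cylindrical_wiener ip W)
  (K : {linear H -> H}) (hK : is_sqrt_op ip Q K)
  (I : R -> {mfun Omega >-> borel H}) (hI : stochastic_convolution ip W S K I)
  (mu : probability (borel H) R) (hmu : centered_gaussian ip mu (Qinf ip S Q))
  (T : R -> (borel H -> R) -> (borel H -> R))
  (hT : L2_extension mu (transition P (OU S I)) T) :
  [<-> L2_symmetric mu T;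
       forall x, adj_dom ip (gen_dom S) (gen S) x ->
         gen_dom S (Q x) /\
         gen S (Q x) = Q (adj ip (gen_dom S) (gen S) x);
       forall t, 0 <= t -> forall x, S t (Q x) = Q (Sadj ip S t x)].
Proof.
tfae.
- move=> Tsym; apply: (intertwine_gen hH hS hQsa).
  apply: (qcov_intertwine hH hS hQ hQsa hinj) => t h k.
  exact: (symmetric_qcov hH hQsa hQ0 hS hinj hW hK hI hmu hT Tsym).
- exact: gen_intertwine.
- move=> SQ; apply: (qcov_symmetric hH hsep hQsa hQ0 hS hinj hW hK hI hmu hT) => t h k.
  exact: intertwine_qcov.
Qed.
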